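(* Let $A,B\in\mathbb{C}^{N\times N}$ be commuting matrices, let $n\ge1$ be an integer and $z\in\mathbb{C}\setminus(-\infty,0]$. Each of the following identities holds whenever all the Bateman matrix polynomials $\mathbf{J}$ appearing in it are defined: $$\mathbf{J}_n^{A,B}(z)=\mathbf{J}_{n-1}^{A,B}(z)+\mathbf{J}_n^{A,B-I}(z),$$ $$A\,\mathbf{J}_n^{A,B-\frac12I}(z)=z\,\mathbf{J}_n^{A-I,B}(z)+z\,\mathbf{J}_{n-1}^{A+I,B}(z),$$ $$(A+nI)\,\mathbf{J}_n^{A,B}(z)=\left(nI+B+\tfrac12A\right)\mathbf{J}_{n-1}^{A,B}(z)+z\,\mathbf{J}_n^{A-I,B+\frac12I}(z).$$
   Context: $I$ is the $N\times N$ identity matrix; for $M\in\mathbb{C}^{N\times N}$, $(M)_0=I$ and $(M)_k=M(M+I)\cdots(M+(k-1)I)$ for $k\ge1$. $\Gamma(M)$ and $\Gamma^{-1}(M)$ (the reciprocal gamma function, entire) are defined by the holomorphic functional calculus, and $z^M=\exp(M\log z)$ with the principal logarithm. For commuting $A,B$ such that $A+I+sI$ and $\frac12A+B+I+sI$ are invertible for every integer $s\ge0$ (in this case we say $\mathbf{J}_n^{A,B}$ is defined), and $n\ge0$, $$\mathbf{J}_n^{A,B}(z)=\frac{\Gamma(\frac12A+B+nI+I)}{n!}\Gamma^{-1}(A+I)\Gamma^{-1}\left(\tfrac12A+B+I\right)z^A\,{}_1F_2\left(-nI;A+I,B+\tfrac12A+I;z^2\right),$$ where ${}_1F_2(P;Q,R;w)=\sum_{k\ge0}\frac{w^k}{k!}(P)_k[(Q)_k]^{-1}[(R)_k]^{-1}$.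 *)

(* Defs.v *)
From HB Require Import structures.
From mathcomp Require Import all_boot all_order all_algebra.
From mathcomp Require Import all_classical all_reals all_analysis.
From mathcomp Require Import complex.
Set Implicit Arguments.
Unset Strict Implicit.
Unset Printing Implicit Defensive.
Import Order.TTheory GRing.Theory Num.Theory.
Import numFieldNormedType.Exports.

Local Open Scope classical_set_scope.
Local Open Scope ring_scope.
Local Open Scope complex_scope.

(* MathComp-Analysis puts the norm topology on R[i]^o only; transferring it to
   R[i] also gives the entrywise topology on matrices over R[i]. *)
#[warnings="-redundant-canonical-projection"]
HB.instance Definition _ (R : rcfType) := NormedModule.copy R[i] (R[i])^o.

Section ComplexFunctions.
Variable R : realType.
Implicit Types z : R[i].

Definition cexp z : R[i] :=
  (expR (complex.Re z))%:C * (cos (complex.Im z) +i* sin (complex.Im z)).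

(* Principal argument, in ]- pi, pi] for z != 0. *)
Definition carg z : R :=
  if 0 <= complex.Im z then acos (complex.Re z / complex.Re `|z|) else - acos (complex.Re z / complex.Re `|z|).

Definition clog z : R[i] := ln (complex.Re `|z|) +i* carg z.

(* Euler-Gauss product:
   1 / Gamma(z) = lim_n z (z + 1) ... (z + n) / (n! n^z). *)
Definition crgamma z : R[i] :=
  limn (fun n : nat => \prod_(k < n.+1) (z + k%:R) /
                       (n`!%:R * cexp (z * (ln n%:R)%:C))).

(* The value 0 at the poles 0, -1, -2, ... is a dummy. *)
Definition cgamma z : R[i] := (crgamma z)^-1.

Definition cintegral (a b : R) (f : R -> R[i]) : R[i] :=
  (\int[lebesgue_measure]_(t in `[a, b]) complex.Re (f t)) +i*
  (\int[lebesgue_measure]_(t in `[a, b]) complex.Im (f t)).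

Definition circle (c : R[i]) (r t : R) : R[i] := c + r%:C * cexp (0 +i* t).

Definition circle_deriv (r t : R) : R[i] := (0 +i* 1) * (r%:C * cexp (0 +i* t)).

(* The positively oriented contour integral of F over |zeta - c| = r. *)
Definition circle_integral (N : nat) (c : R[i]) (r : R)
    (F : R[i] -> 'M[R[i]]_N) : 'M[R[i]]_N :=
  \matrix_(i, j) cintegral 0 (2 * pi)
    (fun t => F (circle c r t) i j * circle_deriv r t).

End ComplexFunctions.

Section MatrixFunctions.
Variables (R : realType) (N : nat).
Implicit Types M P Q S A B : 'M[R[i]]_N.

(* Holomorphic (Riesz-Dunford) functional calculus
     f(M) = (2 pi i)^-1 \oint f(zeta) (zeta I - M)^-1 dzeta
   for f holomorphic near the spectrum of M. The contour is the union of the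
   circles of radius r centred at the eigenvalues of M; the integral does not
   depend on r for small r > 0, and the limit selects this common value. *)
Definition mxfun (f : R[i] -> R[i]) M : 'M[R[i]]_N :=
  lim ((((2 * pi)%:C * (0 +i* 1))^-1 *:
        \sum_(c \in [set c | eigenvalue M c])
           circle_integral c r (fun zeta => f zeta *: invmx (zeta%:M - M)))
       @[r --> (0 : R)^'+]).

Definition mxgamma M := mxfun (@cgamma R) M.
Definition mxrgamma M := mxfun (@crgamma R) M.

Definition mxexp M : 'M[R[i]]_N :=
  limn (series (fun k : nat => (k`!%:R)^-1 *: M ^+ k)).

Definition mxcpow (z : R[i]) M : 'M[R[i]]_N := mxexp (clog z *: M).

Definition mxpoch M (k : nat) : 'M[R[i]]_N := \prod_(i < k) (M + i%:R%:M).

Definition hyp1F2 P Q S (w : R[i]) : 'M[R[i]]_N :=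
  limn (series (fun k : nat =>
    (w ^+ k / k`!%:R) *: (mxpoch P k *m invmx (mxpoch Q k) *m invmx (mxpoch S k)))).

Definition bateman_defined A B : Prop :=
  forall s : nat, A + 1%:M + s%:R%:M \in unitmx /\
                  2^-1 *: A + B + 1%:M + s%:R%:M \in unitmx.

Definition bateman (n : nat) A B (z : R[i]) : 'M[R[i]]_N :=
  (n`!%:R)^-1 *: mxgamma (2^-1 *: A + B + n%:R%:M + 1%:M)
  *m mxrgamma (A + 1%:M)
  *m mxrgamma (2^-1 *: A + B + 1%:M)
  *m mxcpow z A
  *m hyp1F2 (- n%:R%:M) (A + 1%:M) (B + 2^-1 *: A + 1%:M) (z ^+ 2).

End MatrixFunctions.

(* Main.v *)
Require Import Defs.
From mathcomp Require Import all_boot all_order all_algebra.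
From mathcomp Require Import all_classical all_reals all_analysis.
From mathcomp Require Import complex.
From mathcomp Require Import ring lra.
Import Order.TTheory GRing.Theory Num.Theory.
Import numFieldNormedType.Exports.
Local Open Scope classical_set_scope.
Local Open Scope ring_scope.
Local Open Scope complex_scope.
Set Implicit Arguments.
Unset Strict Implicit.
Unset Printing Implicit Defensive.

(** Put C = (1/2) A + B. Up to the scalar 1/n!, the function J_n^(A,B)(z) is the
    product of Gamma(C + n I + I), of the reciprocal gammas at A + I and C + I,
    of z^A, and of a polynomial in z^2 whose coefficients are
      (-n)_k / k! [(A + I)_k]^-1 [(C + I)_k]^-1.
    All these matrices lie in the bicommutant of {A, B}, so they commute with
    each other. The functional equations
      Gamma(M + I) = M Gamma(M),
      Gamma^-1(M) = M Gamma^-1(M + I),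
      z^A = z z^(A - I)
    give the three terms of each identity a common left factor. What is left
    are identities between hypergeometric sums, checked coefficient by
    coefficient: hyp_sum_contiguous, which rests on
    (n - k) (-n)_k = n (1 - n)_k and M [(M)_k]^-1 = (M + k I) [(M + I)_k]^-1,
    gives the first and the third identity, and hyp_sum_shift, where the index
    of summation moves by one, gives the second.

    The functional equations of the two gamma functions come from the
    functional calculus. On a circle that avoids the spectrum of M, the
    resolvent satisfies z (z I - M)^-1 = I + M (z I - M)^-1. Hence the contour
    integral that defines (z f)(M) is M times the one that defines f(M), plus
    the integrals of f over the circles. The latter tend to 0 with the radius as
    soon as f is bounded near the spectrum, which gives mxfun_mulid. It remains
    to know that 1/Gamma is continuous (crgamma_cont), and that it vanishes only
    at 0, -1, -2, ... (crgamma_neq0), so that Gamma is continuous near the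
    spectrum. Both follow from one estimate: consecutive Gauss products differ
    by a factor 1 + O(1/(n (n + 1))), uniformly on every disc
    (gauss_drift_bound), so that the relative distance from the
    n-th product to its limit is at most exp(O(1/n)) - 1.

    The equation for z^A comes from exp(X + Y) = exp(X) exp(Y) for commuting X
    and Y (mxexpD): the gap between the product of the partial sums and the
    partial sum of the product is dominated by the same gap for the real
    exponential, which tends to 0. *)

(** * The modulus of a complex number, as a real number *)

Section ComplexModulus.
Variable R : realType.
Implicit Types z w : R[i].

Definition cabs z : R := complex.Re `|z|.

Lemma cabsE z : `|z| = (cabs z)%:C.
Proof. by rewrite /cabs normc_def. Qed.

Lemma cabs_def z : cabs z = Num.sqrt (complex.Re z ^+ 2 + complex.Im z ^+ 2).
Proof. by rewrite /cabs normc_def. Qed.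

Lemma cabs_ge0 z : 0 <= cabs z.
Proof. by rewrite cabs_def sqrtr_ge0. Qed.

Lemma cabsM z w : cabs (z * w) = cabs z * cabs w.
Proof. by apply: complexI; rewrite rmorphM -!cabsE normrM. Qed.

Lemma cabsD z w : cabs (z + w) <= cabs z + cabs w.
Proof. by rewrite -lecR rmorphD -!cabsE ler_normD. Qed.

Lemma cabsN z : cabs (- z) = cabs z.
Proof. by apply: complexI; rewrite -!cabsE normrN. Qed.

Lemma cabsB z w : cabs (z - w) <= cabs z + cabs w.
Proof. by rewrite -(cabsN w) cabsD. Qed.

Lemma cabs_distC z w : cabs (z - w) = cabs (w - z).
Proof. by rewrite -cabsN opprB. Qed.

Lemma cabsV z : cabs z^-1 = (cabs z)^-1.
Proof. by apply: complexI; rewrite fmorphV -!cabsE normfV. Qed.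

Lemma cabs_eq0 z : (cabs z == 0) = (z == 0).
Proof. by rewrite -(inj_eq (@complexI R)) -cabsE normr_eq0. Qed.

Lemma cabs0 : cabs 0 = 0.
Proof. by apply/eqP; rewrite cabs_eq0. Qed.

Lemma cabs_real (a : R) : cabs a%:C = `|a|.
Proof. by rewrite cabs_def /= expr0n addr0 sqrtr_sqr. Qed.

Lemma cabs1 : cabs 1 = 1.
Proof. by rewrite -[1]/(1%:C) cabs_real normr1. Qed.

Lemma real_complex_nat (n : nat) : (n%:R : R[i]) = (n%:R : R)%:C.
Proof. by rewrite rmorph_nat. Qed.

Lemma cabs_nat (n : nat) : cabs n%:R = n%:R.
Proof. by rewrite real_complex_nat cabs_real ger0_norm. Qed.

Lemma cabsX z n : cabs (z ^+ n) = cabs z ^+ n.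
Proof. by elim: n => [|n ih]; rewrite ?expr0 ?cabs1// !exprS cabsM ih. Qed.

Lemma cabs_sum (I : Type) (s : seq I) (P : pred I) (f : I -> R[i]) :
  cabs (\sum_(k <- s | P k) f k) <= \sum_(k <- s | P k) cabs (f k).
Proof.
elim/big_ind2 : _ => // [|x a y b xa yb]; first by rewrite cabs0.
by rewrite (le_trans (cabsD _ _)) // lerD.
Qed.

Lemma ler_Re_cabs z : `|complex.Re z| <= cabs z.
Proof.
by rewrite cabs_def -sqrtr_sqr ler_wsqrtr // lerDl sqr_ge0.
Qed.

Lemma ler_Im_cabs z : `|complex.Im z| <= cabs z.
Proof.
by rewrite cabs_def -sqrtr_sqr ler_wsqrtr // lerDr sqr_ge0.
Qed.

Lemma cabs_cart (a b : R) : cabs (a +i* b) <= `|a| + `|b|.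
Proof.
have -> : a +i* b = a%:C + (0 +i* b) by simpc.
apply: le_trans (cabsD _ _) _; rewrite cabs_real lerD2l.
by rewrite cabs_def /= expr0n add0r sqrtr_sqr.
Qed.

Lemma ReD z w : complex.Re (z + w) = complex.Re z + complex.Re w.
Proof. by case: z w => [a b] [c d]. Qed.

Lemma ImD z w : complex.Im (z + w) = complex.Im z + complex.Im w.
Proof. by case: z w => [a b] [c d]. Qed.

Lemma ReB z w : complex.Re (z - w) = complex.Re z - complex.Re w.
Proof. by case: z w => [a b] [c d]. Qed.

Lemma ImB z w : complex.Im (z - w) = complex.Im z - complex.Im w.
Proof. by case: z w => [a b] [c d]. Qed.

Lemma eq_Re_Im z w :
  complex.Re z = complex.Re w -> complex.Im z = complex.Im w -> z = w.
Proof. by case: z w => [a b] [c d] /= -> ->. Qed.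

End ComplexModulus.

(** * Limits and continuity of complex functions *)

Section ComplexLimits.
Variable R : realType.
Implicit Types (z w c : R[i]).

(** Convergence is expressed through the real modulus, so that every limit
    below is a limit of real-valued functions. *)
Definition ctends (T : Type) (F : set_system T) (f : T -> R[i]) (a : R[i]) :=
  cabs (f x - a) @[x --> F] --> (0 : R).

Definition ccont (f : R[i] -> R[i]) z := forall e : R, 0 < e ->
  exists2 d : R, 0 < d & forall w, cabs (w - z) < d -> cabs (f w - f z) < e.

(** Continuity in a whole disc around c: this is what integration over the
    small circles around c asks of the integrand. *)
Definition near_ccont (f : R[i] -> R[i]) c :=
  exists2 d : R, 0 < d & forall w, cabs (w - c) < d -> ccont f w.

Section Limits.
Variables (T : Type) (F : set_system T).
Context {FF : ProperFilter F}.
Implicit Types (f g : T -> R[i]) (a b : R[i]).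

Lemma ctendsP f a : (f @ F --> a) <-> ctends F f a.
Proof.
split=> [/cvgrPdist_lt fa|/cvgrPdist_lt fa].
  apply/cvgrPdist_lt => e e0.
  have e0' : 0 < e%:C by rewrite ltcR.
  near=> x; rewrite sub0r normrN ger0_norm ?cabs_ge0 //.
  by rewrite -ltcR -cabsE distrC; near: x; exact: fa.
apply/cvgrPdist_lt => -[e d]; rewrite ltcE /= => /andP[/eqP-> e0].
near=> x; rewrite distrC cabsE ltcR.
rewrite -[ltLHS]ger0_norm ?cabs_ge0 // -normrN -sub0r; near: x; exact: fa.
Unshelve. all: by end_near. Qed.

Lemma ctends_eps f a : ctends F f a <->
  (forall e : R, 0 < e -> \forall x \near F, cabs (f x - a) < e).
Proof.
split=> [/cvgrPdist_lt fa e e0|fa].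
  by apply: filterS (fa e e0) => x; rewrite sub0r normrN ger0_norm ?cabs_ge0.
apply/cvgrPdist_lt => e e0.
by apply: filterS (fa e e0) => x; rewrite sub0r normrN ger0_norm ?cabs_ge0.
Qed.

Lemma ctends_squeeze f a (u : T -> R) :
  (\forall x \near F, cabs (f x - a) <= u x) -> u @ F --> 0 -> ctends F f a.
Proof.
move=> fu u0; apply: (@squeeze_cvgr _ _ _ _ (fun=> 0) u) => //; last exact: cvg_cst.
by apply: filterS fu => x ->; rewrite cabs_ge0.
Qed.

Lemma ctends_cart f a : ctends F f a <->
  (complex.Re (f x) @[x --> F] --> complex.Re a) /\
  (complex.Im (f x) @[x --> F] --> complex.Im a).
Proof.
split=> [/ctends_eps fa|[/cvgrPdist_lt fr /cvgrPdist_lt fi]].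
  split; apply/cvgrPdist_lt => e e0.
    apply: filterS (fa e e0) => x.
    by rewrite distrC -ReB; apply: le_lt_trans; exact: ler_Re_cabs.
  apply: filterS (fa e e0) => x.
  by rewrite distrC -ImB; apply: le_lt_trans; exact: ler_Im_cabs.
apply/ctends_eps => e e0; near=> x.
have -> : f x - a = complex.Re (f x - a) +i* complex.Im (f x - a).
  by case: (_ - _).
rewrite (le_lt_trans (cabs_cart _ _)) // ReB ImB (splitr e) ltrD //.
  by rewrite distrC; near: x; apply: fr; rewrite divr_gt0.
by rewrite distrC; near: x; apply: fi; rewrite divr_gt0.
Unshelve. all: by end_near. Qed.

Lemma ctends_unique f a b : ctends F f a -> ctends F f b -> a = b.
Proof.
move=> /ctends_cart[ar ai] /ctends_cart[br bi].
by apply: eq_Re_Im; [exact: (cvg_unique _ ar br)|exact: (cvg_unique _ ai bi)].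
Qed.

Lemma ctends_near f g a : (\forall x \near F, f x = g x) ->
  ctends F f a -> ctends F g a.
Proof.
move=> fg /ctends_eps fa; apply/ctends_eps => e e0.
by move: (fa e e0) fg; apply: filterS2 => x ? <-.
Qed.

Lemma ctends_cst a : ctends F (fun=> a) a.
Proof. by apply/ctendsP; exact: cvg_cst. Qed.

Lemma cvg_cabs f a : ctends F f a -> cabs (f x) @[x --> F] --> cabs a.
Proof.
move=> /ctends_eps fa; apply/cvgrPdist_lt => e e0.
apply: filterS (fa e e0) => x h.
apply: le_lt_trans h; rewrite ler_norml.
have h1 : cabs a <= cabs (f x) + cabs (f x - a).
  by rewrite cabs_distC -[in leLHS](subrKC (f x) a) cabsD.
have h2 : cabs (f x) <= cabs a + cabs (f x - a).
  by rewrite -[in leLHS](subrKC a (f x)) cabsD.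
by apply/andP; split; lra.
Qed.

Lemma ctendsD f g a b : ctends F f a -> ctends F g b ->
  ctends F (fun x => f x + g x) (a + b).
Proof.
move=> fa gb; apply: (@ctends_squeeze _ _ (fun x => cabs (f x - a) + cabs (g x - b))).
  by apply: nearW => x; rewrite opprD addrACA cabsD.
by rewrite -[0]addr0; apply: cvgD.
Qed.

Lemma ctendsM f g a b : ctends F f a -> ctends F g b ->
  ctends F (fun x => f x * g x) (a * b).
Proof.
move=> fa gb; apply: (@ctends_squeeze _ _
   (fun x => cabs (f x - a) * cabs (g x) + cabs a * cabs (g x - b))).
  apply: nearW => x; rewrite -!cabsM.
  by apply: le_trans (cabsD _ _); rewrite mulrBl mulrBr addrA subrK.
have -> : (0 : R) = 0 * cabs b + cabs a * 0 by rewrite mul0r mulr0 addr0.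
apply: cvgD; apply: cvgM => //; [exact: cvg_cabs|exact: cvg_cst].
Qed.

Lemma ctendsN f a : ctends F f a -> ctends F (fun x => - f x) (- a).
Proof.
by rewrite /ctends; under [X in _ -> X @ _ --> _]eq_fun do rewrite -opprD cabsN.
Qed.

Lemma ctendsB f g a b : ctends F f a -> ctends F g b ->
  ctends F (fun x => f x - g x) (a - b).
Proof. by move=> fa gb; apply: ctendsD => //; exact: ctendsN. Qed.

Lemma ctendsV f a : a != 0 -> ctends F f a -> ctends F (fun x => (f x)^-1) a^-1.
Proof.
move=> a0 fa.
have ca0 : cabs a != 0 by rewrite cabs_eq0.
apply: (@ctends_squeeze _ _ (fun x => cabs (f x - a) * (cabs (f x))^-1 * (cabs a)^-1)).
  have /ctends_eps/(_ (cabs a)) := fa; rewrite lt_neqAle eq_sym ca0 cabs_ge0.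
  move=> /(_ isT); apply: filterS => x fxa.
  have f0 : f x != 0 by apply: contraTneq fxa => ->; rewrite sub0r cabsN ltxx.
  rewrite -!cabsV -!cabsM cabs_distC le_eqVlt; apply/orP; left; apply/eqP; congr cabs.
  by field; rewrite a0 f0.
have -> : (0 : R) = 0 * (cabs a)^-1 * (cabs a)^-1 by rewrite !mul0r.
apply: cvgM; last exact: cvg_cst.
by apply: cvgM => //; apply: cvgV => //; exact: cvg_cabs.
Qed.

Lemma ctends_sum (I : Type) (s : seq I) (P : pred I)
    (f : I -> T -> R[i]) (a : I -> R[i]) :
  (forall k, P k -> ctends F (f k) (a k)) ->
  ctends F (fun x => \sum_(k <- s | P k) f k x) (\sum_(k <- s | P k) a k).
Proof.
move=> fa; elim: s => [|k s ih].
  by under eq_fun do rewrite big_nil; rewrite big_nil; exact: ctends_cst.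
under eq_fun do rewrite big_cons; rewrite big_cons.
by case: ifPn => // Pk; apply: ctendsD => //; exact: fa.
Qed.

Lemma ctends_prod (I : Type) (s : seq I) (P : pred I)
    (f : I -> T -> R[i]) (a : I -> R[i]) :
  (forall k, P k -> ctends F (f k) (a k)) ->
  ctends F (fun x => \prod_(k <- s | P k) f k x) (\prod_(k <- s | P k) a k).
Proof.
move=> fa; elim: s => [|k s ih].
  by under eq_fun do rewrite big_nil; rewrite big_nil; exact: ctends_cst.
under eq_fun do rewrite big_cons; rewrite big_cons.
by case: ifPn => // Pk; apply: ctendsM => //; exact: fa.
Qed.

Lemma ctends_real (u : T -> R) (c : R) :
  u @ F --> c -> ctends F (fun x => (u x)%:C) c%:C.
Proof. by move=> uc; apply/ctends_cart; split => //; exact: cvg_cst. Qed.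

Lemma ctends_comp f (g : R[i] -> R[i]) a :
  ctends F f a -> ccont g a -> ctends F (g \o f) (g a).
Proof.
move=> /ctends_eps fa ga; apply/ctends_eps => e /ga[d d0 gd].
by apply: filterS (fa d d0) => x /gd.
Qed.

End Limits.

Lemma cauchy_ctends (u : nat -> R[i]) :
  (forall e : R, 0 < e -> exists K, forall n, (K <= n)%N -> cabs (u n - u K) <= e) ->
  exists a, ctends \oo u a.
Proof.
move=> uC.
have real_cauchy (v : nat -> R) :
    (forall m n, `|v n - v m| <= cabs (u n - u m)) -> cvgn v.
  move=> vu; apply: cauchy_cvg; apply/cauchy_exP => e e0.
  have [K hK] := uC (e / 2) (divr_gt0 e0 (ltr0Sn _ _)).
  exists (v K); exists K => // n /= Kn; change (`|v K - v n| < e).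
  by rewrite distrC (le_lt_trans (vu _ _)) // (le_lt_trans (hK _ Kn)) //; lra.
have /cvg_ex[/= r hr] : cvgn (fun n => complex.Re (u n)).
  by apply: real_cauchy => m n; rewrite -ReB ler_Re_cabs.
have /cvg_ex[/= s hs] : cvgn (fun n => complex.Im (u n)).
  by apply: real_cauchy => m n; rewrite -ImB ler_Im_cabs.
by exists (r +i* s); apply/ctends_cart.
Qed.

Lemma ctends_lim (T : Type) (F : set_system T) {FF : ProperFilter F}
    (f : T -> R[i]) a : ctends F f a -> lim (f @ F) = a.
Proof. by move=> /ctendsP; exact: cvg_lim. Qed.

End ComplexLimits.

(** * Entrywise limits of matrices *)

Section MatrixLimits.
Variables (R : realType) (T : Type) (F : set_system T).
Context {FF : ProperFilter F}.

Definition mtends (m n : nat) (g : T -> 'M[R[i]]_(m, n)) (L : 'M[R[i]]_(m, n)) :=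
  forall i j, ctends F (fun x => g x i j) (L i j).

(** The topology of matrices is entrywise; a neighbourhood of a matrix is cut
    out by finitely many conditions, one for each entry. *)
Lemma mtendsP m n (g : T -> 'M[R[i]]_(m, n)) L : (g @ F --> L) <-> mtends g L.
Proof.
split=> [gL i j|gL].
  apply/ctendsP => B LB; apply: (gL [set X | B (X i j)]).
  exists (fun k l => [set x | (k == i) && (l == j) -> B x]) => [k l|X /= XB].
    have [/andP[/eqP-> /eqP->]|_] := boolP (_ && _).
      by apply: filterS LB => y By _.
    by apply: filterS filterT.
  by apply: XB; rewrite !eqxx.
move=> A [P LP PA].
suff : \forall x \near F, forall ij : 'I_m * 'I_n, P ij.1 ij.2 (g x ij.1 ij.2).
  by apply: filterS => x Px; apply: PA => i j; exact: (Px (i, j)).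
apply: filter_forall => -[i j] /=.
by have /ctendsP := gL i j; apply; exact: LP.
Qed.

Lemma mtends_lim m n (g : T -> 'M[R[i]]_(m, n)) L : mtends g L -> lim (g @ F) = L.
Proof. by move=> /mtendsP; exact: cvg_lim. Qed.

Lemma mtends_unique m n (g : T -> 'M[R[i]]_(m, n)) L L' :
  mtends g L -> mtends g L' -> L = L'.
Proof.
by move=> gL gL'; apply/matrixP => i j; exact: (ctends_unique (gL i j) (gL' i j)).
Qed.

Lemma mtends_near m n (g h : T -> 'M[R[i]]_(m, n)) L :
  (\forall x \near F, g x = h x) -> mtends g L -> mtends h L.
Proof.
move=> gh gL i j; apply: ctends_near (gL i j).
by apply: filterS gh => x ->.
Qed.

Lemma mtends_cst m n (L : 'M[R[i]]_(m, n)) : mtends (fun=> L) L.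
Proof. by move=> i j; exact: ctends_cst. Qed.

Lemma mtendsD m n (g h : T -> 'M[R[i]]_(m, n)) L L' :
  mtends g L -> mtends h L' -> mtends (fun x => g x + h x) (L + L').
Proof.
move=> gL hL i j; rewrite mxE.
under [X in ctends _ X]eq_fun do rewrite mxE.
exact: ctendsD.
Qed.

Lemma mtendsM m n p (g : T -> 'M[R[i]]_(m, n)) (h : T -> 'M[R[i]]_(n, p)) L L' :
  mtends g L -> mtends h L' -> mtends (fun x => g x *m h x) (L *m L').
Proof.
move=> gL hL i j; rewrite mxE.
under [X in ctends _ X]eq_fun do rewrite mxE.
by apply: ctends_sum => k _; exact: ctendsM.
Qed.

Lemma mtendsZ m n (k : R[i]) (g : T -> 'M[R[i]]_(m, n)) L :
  mtends g L -> mtends (fun x => k *: g x) (k *: L).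
Proof.
move=> gL i j; rewrite mxE.
under [X in ctends _ X]eq_fun do rewrite mxE.
by apply: ctendsM => //; exact: ctends_cst.
Qed.

Lemma mtends_sum m n (I : Type) (s : seq I) (P : pred I)
    (g : I -> T -> 'M[R[i]]_(m, n)) L :
  (forall k, P k -> mtends (g k) (L k)) ->
  mtends (fun x => \sum_(k <- s | P k) g k x) (\sum_(k <- s | P k) L k).
Proof.
move=> gL i j; rewrite summxE.
under [X in ctends _ X]eq_fun do rewrite summxE.
by apply: ctends_sum => k Pk; exact: gL.
Qed.

Lemma mtendsN m n (g : T -> 'M[R[i]]_(m, n)) L :
  mtends g L -> mtends (fun x => - g x) (- L).
Proof.
move=> gL i j; rewrite mxE.
under [X in ctends _ X]eq_fun do rewrite mxE.
exact: ctendsN.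
Qed.

End MatrixLimits.

(** * Partial sums of Cauchy products *)

Section CauchyProduct.
Variable V : pzRingType.

Lemma cauchy_triangle (f : nat -> nat -> V) n :
  \sum_(0 <= k < n) \sum_(i < k.+1) f (k - i)%N i =
  \sum_(0 <= i < n) \sum_(0 <= j < n - i) f j i.
Proof.
elim: n => [|n ih]; first by rewrite !big_geq.
rewrite [LHS]big_nat_recr //= ih [RHS]big_nat_recr //= subSnn big_nat1.
rewrite big_ord_recr /= subnn addrA; congr (_ + _).
rewrite -(big_mkord predT (fun i => f (n - i)%N i)) -big_split /=.
rewrite !big_nat; apply: eq_bigr => i /andP[_ ni].
by rewrite subSn 1?ltnW // big_nat_recr.
Qed.

(** The square of index pairs minus the triangle i + j < n: the remainder
    collects the products whose total degree is at least n. *)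
Lemma cauchy_square (x y s : nat -> V) n :
  (forall k, s k = \sum_(i < k.+1) x (k - i)%N * y i) ->
  series x n * series y n - series s n =
  \sum_(0 <= i < n) \sum_(n - i <= j < n) x j * y i.
Proof.
move=> sE; rewrite /series /= (eq_bigr _ (fun k _ => sE k)).
rewrite (cauchy_triangle (fun j i => x j * y i)).
rewrite mulr_sumr -sumrB; apply: eq_bigr => i _.
by rewrite (big_cat_nat _ (leq_subr i n)) //= mulrDl mulr_suml addrC addKr mulr_suml.
Qed.

End CauchyProduct.

(** * The exponential of a matrix and of a complex number *)

Section MatrixExponential.
Variables (R : realType).

(** A norm for which the entries of X ^+ k are bounded by the k-th power of
    the norm of X. *)
Definition entry_sum N (X : 'M[R[i]]_N) : R := \sum_i \sum_j cabs (X i j).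

Lemma entry_sum_ge0 N (X : 'M[R[i]]_N) : 0 <= entry_sum X.
Proof. by do 2!apply: sumr_ge0 => ? _; exact: cabs_ge0. Qed.

Lemma cabs_expmx N (X : 'M[R[i]]_N) k i j : cabs ((X ^+ k) i j) <= entry_sum X ^+ k.
Proof.
elim: k i j => [|k ih] i j.
  by rewrite !expr0 mxE; case: eqP => _; rewrite ?cabs1 ?cabs0.
rewrite !exprS mxE (le_trans (cabs_sum _ _ _)) //.
apply: (@le_trans _ _ (\sum_l cabs (X i l) * entry_sum X ^+ k)).
  by apply: ler_sum => l _; rewrite cabsM ler_wpM2l ?cabs_ge0.
rewrite -mulr_suml ler_wpM2r ?exprn_ge0 ?entry_sum_ge0 //.
rewrite /entry_sum [leRHS](bigD1 i) //= lerDl.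
by do 2!apply: sumr_ge0 => ? _; exact: cabs_ge0.
Qed.

Definition mexp_coeff N (X : 'M[R[i]]_N) k : 'M[R[i]]_N := (k`!%:R)^-1 *: X ^+ k.

Lemma cabs_mexp_coeff N (X : 'M[R[i]]_N) k i j :
  cabs (mexp_coeff X k i j) <= exp_coeff (entry_sum X) k.
Proof.
rewrite mxE cabsM cabsV cabs_nat /exp_coeff /= mulrC.
by rewrite ler_wpM2r ?invr_ge0 // cabs_expmx.
Qed.

Lemma series_dominated (u : nat -> R[i]) (v : nat -> R) :
  (forall k, cabs (u k) <= v k) -> cvgn (series v) ->
  exists a, ctends \oo (series u) a.
Proof.
move=> uv /cvg_ex[/= l /cvgrPdist_lt vl]; apply: cauchy_ctends => e e0.
have [K _ hK] := vl _ (divr_gt0 e0 (ltr0Sn R 1)).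
exists K => n Kn; have lK := hK K (leqnn K); have ln := hK n Kn.
have -> : series u n - series u K = \sum_(K <= k < n) u k.
  by rewrite sub_series_geq.
apply: le_trans (cabs_sum _ _ _) _.
apply: (@le_trans _ _ (\sum_(K <= k < n) v k)); first exact: ler_sum.
have -> : \sum_(K <= k < n) v k = series v n - series v K.
  by rewrite sub_series_geq.
move: lK ln; rewrite !ltr_norml => /andP[? ?] /andP[? ?].
by lra.
Qed.

Lemma series_mxE N (u : nat -> 'M[R[i]]_N) i j :
  (fun n => series u n i j) = series (fun k => u k i j).
Proof. by apply/funext => n; rewrite /series /= summxE. Qed.

Lemma mxexp_tends N (X : 'M[R[i]]_N) : mtends \oo (series (mexp_coeff X)) (mxexp X).
Proof.
have [L hL] : exists L, mtends \oo (series (mexp_coeff X)) L.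
  have /choice[L hL] : forall ij : 'I_N * 'I_N, exists a,
      ctends \oo (series (fun k => mexp_coeff X k ij.1 ij.2)) a.
    move=> [i j] /=; apply: (@series_dominated _ (exp_coeff (entry_sum X))).
      by move=> k; exact: cabs_mexp_coeff.
    exact: is_cvg_series_exp_coeff.
  exists (\matrix_(i, j) L (i, j)) => i j.
  by rewrite series_mxE mxE; exact: (hL (i, j)).
by rewrite [mxexp X](mtends_lim hL).
Qed.

Lemma mexp_coeffD N (X Y : 'M[R[i]]_N) k : GRing.comm X Y ->
  mexp_coeff (X + Y) k = \sum_(i < k.+1) mexp_coeff X (k - i)%N * mexp_coeff Y i.
Proof.
move=> XY; rewrite /mexp_coeff exprDn_comm // scaler_sumr; apply: eq_bigr => i _.
rewrite -!mulmxE -scalemxAl -scalemxAr. rewrite -[_ *+ 'C(_, _)](@scaler_nat R[i]) !scalerA.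
congr (_ *: _); have ik : (i <= k)%N by rewrite -ltnS.
have := congr1 (fun n => n%:R : R[i]) (bin_fact ik); rewrite !natrM => <-.
by field; rewrite !pnatr_eq0 -!lt0n !fact_gt0 bin_gt0 ik.
Qed.

Lemma exp_coeffD (x y : R) k :
  exp_coeff (x + y) k = \sum_(i < k.+1) exp_coeff x (k - i)%N * exp_coeff y i.
Proof.
rewrite /exp_coeff /= exprDn mulr_suml; apply: eq_bigr => i _.
have ik : (i <= k)%N by rewrite -ltnS.
have := congr1 (fun n => n%:R : R) (bin_fact ik); rewrite !natrM => <-.
rewrite -[_ *+ 'C(_, _)]mulr_natl.
by field; rewrite !pnatr_eq0 -!lt0n !fact_gt0 bin_gt0 ik.
Qed.

(** Entry by entry, the remainder left by [cauchy_square] for X and Y is at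
    most N times the remainder for the real exponential series at the norms of
    X and Y. The latter tends to expR x * expR y - expR (x + y) = 0. *)
Lemma mxexpD N (X Y : 'M[R[i]]_N) : GRing.comm X Y ->
  mxexp (X + Y) = mxexp X *m mxexp Y.
Proof.
move=> XY; set x := entry_sum X; set y := entry_sum Y.
pose S z n := series (@exp_coeff R z) n.
have ST z : S z @ \oo --> expR z by exact: is_cvg_series_exp_coeff.
apply: (@mtends_unique _ _ \oo _ _ _ (series (mexp_coeff (X + Y)))).
  exact: mxexp_tends.
have XYT := mtendsM (FF := eventually_filter) (mxexp_tends X) (mxexp_tends Y).
suff D0 : mtends \oo (fun n => series (mexp_coeff X) n *m series (mexp_coeff Y) n -
    series (mexp_coeff (X + Y)) n) 0.
  have := mtendsD (FF := eventually_filter) XYT (mtendsN D0); rewrite oppr0 addr0.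
  by under eq_fun do rewrite opprB subrKC.
move=> i j; rewrite mxE.
apply: (@ctends_squeeze _ _ _ _ _ _ (fun n => N%:R * (S x n * S y n - S (x + y) n))); last first.
  have -> : (0 : R) = N%:R * (expR x * expR y - expR (x + y)).
    by rewrite expRD subrr mulr0.
  apply: cvgM; first exact: cvg_cst.
  by apply: cvgB => //; apply: cvgM.
apply: nearW => n; rewrite subr0 /S.
rewrite (cauchy_square _ (fun k => exp_coeffD x y k)).
rewrite mulmxE (cauchy_square _ (fun k => mexp_coeffD k XY)).
rewrite summxE mulr_sumr (le_trans (cabs_sum _ _ _)) //; apply: ler_sum => k _.
rewrite summxE mulr_sumr (le_trans (cabs_sum _ _ _)) //; apply: ler_sum => l _.
rewrite -mulmxE mxE (le_trans (cabs_sum _ _ _)) //.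
apply: (@le_trans _ _ (\sum_(m < N) exp_coeff x l * exp_coeff y k)).
  apply: ler_sum => m _; rewrite cabsM ler_pM ?cabs_ge0 //.
    exact: cabs_mexp_coeff.
  exact: cabs_mexp_coeff.
by rewrite sumr_const card_ord mulr_natl.
Qed.

Lemma mexp_coeff_scalar N (z : R[i]) k :
  mexp_coeff (z%:M : 'M[R[i]]_N) k = (z ^+ k / k`!%:R)%:M.
Proof.
rewrite /mexp_coeff (_ : z%:M ^+ k = (z ^+ k)%:M); last first.
  by elim: k => [|k ih]; rewrite ?expr0// !exprS ih -mulmxE -scalar_mxM.
by rewrite scale_scalar_mx mulrC.
Qed.

Lemma mxexp_scalar_tends N (z l : R[i]) :
  ctends \oo (series (fun k => z ^+ k / k`!%:R)) l -> mxexp (z%:M : 'M[R[i]]_N) = l%:M.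
Proof.
move=> zl; apply: (mtends_unique (mxexp_tends _)) => i j.
rewrite series_mxE mxE.
have -> : (fun k => mexp_coeff (z%:M : 'M[R[i]]_N) k i j) =
          (fun k => (z ^+ k / k`!%:R) *+ (i == j)).
  by apply/funext => k; rewrite mexp_coeff_scalar mxE.
case: eqP => _; rewrite ?mulr1n//; under eq_fun do rewrite mulr0n.
rewrite mulr0n; have -> : series (fun=> 0 : R[i]) = (fun=> 0).
  by apply/funext => n; rewrite /series /= big1.
exact: ctends_cst.
Qed.

Lemma cexp_real_series (x : R) :
  ctends \oo (series (fun k => x%:C ^+ k / k`!%:R)) (expR x)%:C.
Proof.
have -> : series (fun k => x%:C ^+ k / k`!%:R) = fun n => (series (exp_coeff x) n)%:C.
  apply/funext => n; rewrite /series /= rmorph_sum; apply: eq_bigr => k _.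
  by rewrite /exp_coeff /= rmorphM fmorphV rmorphXn rmorph_nat.
by apply: ctends_real; exact: is_cvg_series_exp_coeff.
Qed.

(** The parity pattern is the one of the coefficients of the power series of
    cos and sin. *)
Lemma imag_exp (x : R) k :
  (0 +i* x) ^+ k = (((~~ odd k)%:R * (-1) ^+ k./2 * x ^+ k) +i*
                    ((odd k)%:R * (-1) ^+ k.-1./2 * x ^+ k)).
Proof.
elim: k => [|k ih].
  by apply: eq_Re_Im => /=; rewrite ?mulr0n ?mulr1n !expr0 ?mulr1 ?mul0r.
have mulI (a b : R) : (0 +i* x) * (a +i* b) = (- (x * b)) +i* (x * a) by simpc.
rewrite exprS ih mulI /= negbK uphalfE; congr Complex; rewrite exprS.
  case: k {ih} => [|k] /=; first by rewrite !mulr0n !mul0r mulr0 oppr0.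
  by rewrite [(-1) ^+ _.+1]exprS; ring.
by ring.
Qed.

Lemma cexp_imag_series (x : R) :
  ctends \oo (series (fun k => (0 +i* x) ^+ k / k`!%:R)) (cos x +i* sin x).
Proof.
have -> : series (fun k => (0 +i* x) ^+ k / k`!%:R) =
          fun n => (series (cos_coeff x) n +i* series (sin_coeff x) n).
  apply/funext => n; rewrite /series /=; elim: n => [|n ih].
    by rewrite !big_geq.
  rewrite !big_nat_recr //= ih imag_exp /cos_coeff /sin_coeff /=.
  by rewrite real_complex_nat -fmorphV; simpc.
apply/ctends_cart; rewrite unlock; split => /=.
  exact: is_cvg_series_cos_coeff.
rewrite unlock.
exact: is_cvg_series_sin_coeff.
Qed.

(** The definition of [cexp] by cos and sin agrees with the exponential series:
    split z into its real and imaginary parts and use [mxexpD]. The scalar facts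
    [cexp_series] and [cexpD] are then read off from matrices of size 1. *)
Lemma mxexp_scalar N (z : R[i]) : mxexp (z%:M : 'M[R[i]]_N) = (cexp z)%:M.
Proof.
case: z => x y; have -> : x +i* y = x%:C + (0 +i* y) by simpc.
rewrite raddfD /= mxexpD; last first.
  by rewrite /GRing.comm -!mulmxE -!scalar_mxM mulrC.
rewrite (mxexp_scalar_tends _ (@cexp_real_series x)).
rewrite (mxexp_scalar_tends _ (@cexp_imag_series y)).
by rewrite -scalar_mxM /cexp; simpc.
Qed.

Lemma cexp_series (z : R[i]) :
  ctends \oo (series (fun k => z ^+ k / k`!%:R)) (cexp z).
Proof.
have := @mxexp_tends 1 z%:M ord0 ord0.
rewrite mxexp_scalar mxE eqxx mulr1n series_mxE.
by under eq_fun do rewrite mexp_coeff_scalar mxE eqxx mulr1n.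
Qed.

Lemma cexpD (z w : R[i]) : cexp (z + w) = cexp z * cexp w.
Proof.
have := @mxexpD 1 z%:M w%:M; rewrite -raddfD /= !mxexp_scalar -scalar_mxM.
move=> /(_ _)/matrixP/(_ ord0 ord0); rewrite !mxE eqxx !mulr1n; apply.
by rewrite /GRing.comm -!mulmxE -!scalar_mxM mulrC.
Qed.

Lemma cexp0 : cexp (0 : R[i]) = 1.
Proof. by rewrite /cexp /= expR0 cos0 sin0; simpc. Qed.

Lemma cabs_cexp (z : R[i]) : cabs (cexp z) = expR (complex.Re z).
Proof.
rewrite /cexp cabsM cabs_real ger0_norm ?expR_ge0 //.
by rewrite [X in _ * X]cabs_def /= cos2Dsin2 sqrtr1 mulr1.
Qed.

Lemma cexp_neq0 (z : R[i]) : cexp z != 0.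
Proof. by rewrite -cabs_eq0 cabs_cexp expR_eq0. Qed.

Lemma expR_taylor (x : R) : 0 <= x -> expR x - 1 - x <= x ^+ 2 * expR x.
Proof.
move=> x0; have e0 := expR_gt0 x.
have h : expR x - 1 <= x * expR x.
  have := expR_ge1Dx (- x); rewrite expRN.
  rewrite -(ler_pM2r e0) mulVf ?gt_eqF // => ?; nra.
nra.
Qed.

(** The power series of cexp z - 1 - z is dominated term by term by the one of
    expR |z| - 1 - |z|. *)
Lemma cexp_taylor (z : R[i]) :
  cabs (cexp z - 1 - z) <= cabs z ^+ 2 * expR (cabs z).
Proof.
apply: le_trans (expR_taylor (cabs_ge0 z)).
have T : ctends \oo (fun n => series (fun k => z ^+ k / k`!%:R) n - 1 - z) (cexp z - 1 - z).
  by do 2?apply: ctendsB; [exact: cexp_series|exact: ctends_cst|exact: ctends_cst].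
have TR : (series (exp_coeff (cabs z)) n - 1 - cabs z) @[n --> \oo]
            --> expR (cabs z) - 1 - cabs z.
  by do 2?apply: cvgB; [exact: is_cvg_series_exp_coeff|exact: cvg_cst|exact: cvg_cst].
rewrite -(cvg_lim _ (cvg_cabs T)) // -(cvg_lim _ TR) //.
apply: ler_lim.
- by apply/cvg_ex; exists (cabs (cexp z - 1 - z)); exact: cvg_cabs.
- by apply/cvg_ex; exists (expR (cabs z) - 1 - cabs z).
near=> n; have n2 : (2 <= n)%N by near: n; exact: nbhs_infty_ge.
have n1 := ltnW n2; rewrite /series /= (big_ltn n1) (big_ltn n2).
rewrite [X in _ <= X - _ - _](big_ltn n1) [X in _ <= (_ + X) - _ - _](big_ltn n2).
rewrite /exp_coeff /= !expr0 !expr1 !divr1 ![(1 + (_ + _))]addrA.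
rewrite (_ : 1 + z + _ - 1 - z = \sum_(2 <= k < n) z ^+ k / k`!%:R); last by ring.
rewrite (_ : 1 + cabs z + _ - 1 - cabs z = \sum_(2 <= k < n) cabs z ^+ k / k`!%:R); last by ring.
apply: le_trans (cabs_sum _ _ _) _; apply: ler_sum => k _.
by rewrite cabsM cabsX cabsV cabs_nat.
Unshelve. all: by end_near. Qed.

Lemma cexp_cont (z : R[i]) : ccont (@cexp R) z.
Proof.
have bnd (h : R[i]) : cabs h <= 1 -> cabs (cexp h - 1) <= cabs h * (1 + expR 1).
  move=> h1; have -> : cexp h - 1 = (cexp h - 1 - h) + h by rewrite subrK.
  apply: le_trans (cabsD _ _) _; rewrite mulrDr mulr1 addrC lerD2l.
  apply: le_trans (cexp_taylor _) _.
  rewrite expr2 -mulrA ler_wpM2l ?cabs_ge0 //.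
  by rewrite -[leRHS]mul1r ler_pM ?cabs_ge0 ?expR_ge0 // ler_expR.
move=> e e0; pose M := cabs (cexp z) * (1 + expR 1).
have M0 : 0 < M by rewrite mulr_gt0 // ?cabs_cexp ?expR_gt0 // addr_gt0 ?expR_gt0.
exists (Num.min 1 (e / M)); first by rewrite lt_min ltr01 divr_gt0.
move=> w; rewrite lt_min => /andP[w1 w2].
have -> : cexp w - cexp z = cexp z * (cexp (w - z) - 1).
  by rewrite mulrBr mulr1 -cexpD subrKC.
rewrite cabsM; apply: le_lt_trans (_ : cabs (w - z) * M < e).
  by rewrite /M mulrCA ler_wpM2l ?cabs_ge0 // bnd // ltW.
by rewrite -ltr_pdivlMr.
Qed.

End MatrixExponential.

Section Continuity.
Variable R : realType.
Implicit Types (f g : R[i] -> R[i]) (z : R[i]).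

Lemma ccontP f z : ccont f z <-> ctends (nbhs z) f (f z).
Proof.
split=> [fz|/ctends_eps fz e e0].
  apply/ctends_eps => e /fz[d d0 fd].
  apply/nbhs_ballP; exists d%:C; first by rewrite /= ltcR.
  by move=> w; rewrite /ball /= distrC cabsE ltcR; exact: fd.
have /nbhs_ballP[[d d'] /=] := fz e e0.
rewrite ltcE /= => /andP[/eqP-> d0] fd; exists d => // w wz.
by apply: fd; rewrite /ball /= distrC cabsE ltcR.
Qed.

Lemma ccont_cst (c : R[i]) z : ccont (fun=> c) z.
Proof. by apply/ccontP; exact: ctends_cst. Qed.

Lemma ccont_id z : ccont id z.
Proof. by move=> e e0; exists e. Qed.

Lemma ccontD f g z : ccont f z -> ccont g z -> ccont (fun w => f w + g w) z.
Proof. by move=> /ccontP fz /ccontP gz; apply/ccontP; exact: ctendsD. Qed.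

Lemma ccontM f g z : ccont f z -> ccont g z -> ccont (fun w => f w * g w) z.
Proof. by move=> /ccontP fz /ccontP gz; apply/ccontP; exact: ctendsM. Qed.

Lemma ccontV f z : f z != 0 -> ccont f z -> ccont (fun w => (f w)^-1) z.
Proof. by move=> f0 /ccontP fz; apply/ccontP; exact: ctendsV. Qed.

Lemma ccont_prod (I : Type) (s : seq I) (P : pred I) (f : I -> R[i] -> R[i]) z :
  (forall k, P k -> ccont (f k) z) ->
  ccont (fun w => \prod_(k <- s | P k) f k w) z.
Proof.
by move=> fz; apply/ccontP; apply: ctends_prod => k Pk; apply/ccontP; exact: fz.
Qed.

Lemma ccont_comp f g z : ccont f z -> ccont g (f z) -> ccont (g \o f) z.
Proof. by move=> /ccontP fz gz; apply/ccontP; exact: ctends_comp. Qed.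

End Continuity.

(** * Products whose factors tend to one *)

Section InfiniteProduct.
Variable R : realType.

(** If the n-th factor is 1 + a n with |a n| <= b n, then |p n| is at most
    |p K| exp(S) where S is the sum of the b k for K <= k < n, and the drift
    |p n - p K| is at most |p K| (exp(S) - 1), by 1 + b <= exp(b). Here b n is
    C (1/n - 1/(n+1)), for which S telescopes. *)
Lemma product_drift (p a : nat -> R[i]) (C : R) K :
  (forall n, (K <= n)%N -> p n.+1 = p n * (1 + a n)) ->
  (forall n, (K <= n)%N -> cabs (a n) <= C * (n%:R^-1 - n.+1%:R^-1)) ->
  forall n, (K <= n)%N ->
  cabs (p n - p K) <= cabs (p K) * (expR (C * (K%:R^-1 - n%:R^-1)) - 1).
Proof.
move=> pS aC; elim=> [|n ih].
  by rewrite leqn0 => /eqP ->; rewrite !subrr mulr0 expR0 subrr mulr0 cabs0.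
rewrite leq_eqVlt => /predU1P[<-|].
  by rewrite !subrr mulr0 expR0 subrr mulr0 cabs0.
rewrite ltnS => Kn; move/(_ Kn) : ih => ih; have bC := aC n Kn.
set b := C * (n%:R^-1 - _) in bC.
have -> : C * (K%:R^-1 - n.+1%:R^-1) = C * (K%:R^-1 - n%:R^-1) + b.
  by rewrite /b -mulrDr addrA subrK.
move: ih; set S := C * (K%:R^-1 - n%:R^-1); rewrite expRD => ih.
have -> : p n.+1 - p K = (p n - p K) + p n * a n.
  by rewrite pS // mulrDr mulr1 addrAC.
have pn : cabs (p n) <= cabs (p K) * expR S.
  have -> : p n = p K + (p n - p K) by rewrite subrKC.
  apply: le_trans (cabsD _ _) _; lra.
apply: le_trans (cabsD _ _) _; rewrite cabsM.
have b0 : 0 <= b by apply: le_trans bC; exact: cabs_ge0.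
have h : cabs (p n) * cabs (a n) <= cabs (p K) * expR S * b.
  by rewrite ler_pM ?cabs_ge0.
have eb : cabs (p K) * expR S * b <= cabs (p K) * expR S * (expR b - 1).
  rewrite ler_wpM2l ?mulr_ge0 ?cabs_ge0 ?expR_ge0 //.
  by have := expR_ge1Dx b; lra.
lra.
Qed.

Lemma cvg_expR_drift (C : R) : (expR (C * n.+1%:R^-1) - 1) @[n --> \oo] --> (0 : R).
Proof.
have h : C * n.+1%:R^-1 @[n --> \oo] --> C * 0.
  exact: (cvgM (cvg_cst C) (@cvg_harmonic R)).
have he : expR (C * n.+1%:R^-1) @[n --> \oo] --> expR (C * 0).
  by apply: continuous_cvg => //; exact: continuous_expR.
rewrite (_ : 0 = expR (C * 0) - 1); last by rewrite mulr0 expR0 subrr.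
exact: (cvgB he (cvg_cst (1 : R))).
Qed.

End InfiniteProduct.

(** * The reciprocal gamma function *)

Section ReciprocalGamma.
Variable R : realType.
Implicit Types (z w : R[i]) (r : R) (n K : nat).

Definition gauss_rgamma z n : R[i] :=
  \prod_(k < n.+1) (z + k%:R) / (n`!%:R * cexp (z * (ln n%:R)%:C)).

Definition log_step n : R := ln n.+1%:R - ln n%:R.

(** The relative change between two consecutive Gauss products. *)
Definition gauss_drift z n : R[i] :=
  (1 + z / n.+1%:R) * cexp (- (z * (log_step n)%:C)) - 1.

Lemma gauss_rgammaS z n :
  gauss_rgamma z n.+1 = gauss_rgamma z n * (1 + gauss_drift z n).
Proof.
rewrite /gauss_rgamma /gauss_drift subrKC big_ord_recr /= factS natrM.
have -> : z * (ln n.+1%:R)%:C = z * (ln n%:R)%:C + z * (log_step n)%:C.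
  by rewrite -mulrDr -rmorphD /= subrKC.
have cN : cexp (- (z * (log_step n)%:C)) = (cexp (z * (log_step n)%:C))^-1.
  apply: (mulIf (cexp_neq0 (z * (log_step n)%:C))).
  by rewrite -cexpD addNr cexp0 mulVf ?cexp_neq0.
rewrite cexpD cN.
have h1 := cexp_neq0 (z * (ln n%:R)%:C); have h2 := cexp_neq0 (z * (log_step n)%:C).
have h3 : (n.+1%:R : R[i]) != 0 by rewrite pnatr_eq0.
have h4 : (n`!%:R : R[i]) != 0 by rewrite pnatr_eq0 -lt0n fact_gt0.
move: (n.+1%:R : R[i]) h3 => s h3.
by field; rewrite h1 h2 h4 h3.
Qed.

Lemma log_step_itv n : (0 < n)%N -> n.+1%:R^-1 <= log_step n <= n%:R^-1.
Proof.
move=> n0; have n0' : (0 : R) < n%:R by rewrite ltr0n.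
have n1' : (0 : R) < n.+1%:R by rewrite ltr0n.
have Sn : n.+1%:R = n%:R + 1 :> R by rewrite -natr1.
apply/andP; split.
  have -> : log_step n = - ln (1 + - n.+1%:R^-1).
    rewrite (_ : 1 + - n.+1%:R^-1 = n%:R / n.+1%:R); last by rewrite Sn; field; rewrite -Sn gt_eqF.
    by rewrite ln_div ?posrE // opprB.
  rewrite lerNr; apply: le_ln1Dx.
  by rewrite ltrN2 invf_lt1 // ltr1n ltnS.
have -> : log_step n = ln (1 + n%:R^-1).
  rewrite (_ : 1 + n%:R^-1 = n.+1%:R / n%:R); last by rewrite Sn; field; rewrite gt_eqF.
  by rewrite ln_div ?posrE.
by apply: le_ln1Dx; rewrite (lt_trans (ltrN10 _)) // invr_gt0.
Qed.

(** The constant that comes out of the second-order expansion in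
    [gauss_drift_bound] on the disc of radius r. *)
Definition drift_const r : R := r + r ^+ 2 + 2 * (1 + r) * r ^+ 2 * expR r.

Lemma drift_const_ge0 r : 0 <= r -> 0 <= drift_const r.
Proof.
move=> r0; rewrite /drift_const !addr_ge0 ?sqr_ge0 //.
by rewrite !mulr_ge0 ?expR_ge0 ?sqr_ge0 // addr_ge0.
Qed.

(** With y = 1/(n+1) and d = ln(n+1) - ln n, the factor (1 + z y) exp(- z d)
    equals 1 + z (y - d) up to terms of second order. Since y <= d <= 1/n, both
    y - d and the second-order terms are O(1/n - 1/(n+1)). *)
Lemma gauss_drift_bound r z n : (0 < n)%N -> cabs z <= r ->
  cabs (gauss_drift z n) <= drift_const r * (n%:R^-1 - n.+1%:R^-1).
Proof.
move=> n0 zr; have r0 : 0 <= r by rewrite (le_trans (cabs_ge0 z)).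
have /andP[dl du] := log_step_itv n0.
set d := log_step n in dl du *.
set x := n%:R^-1 in du *; set y := n.+1%:R^-1 in dl *.
have n0' : (0 : R) < n%:R by rewrite ltr0n.
have n1' : (0 : R) < n.+1%:R by rewrite ltr0n.
have Sn : n.+1%:R = n%:R + 1 :> R by rewrite -natr1.
have x0 : 0 <= x by rewrite invr_ge0 ltW.
have y0 : 0 <= y by rewrite invr_ge0 ltW.
have d0 : 0 <= d by rewrite (le_trans y0).
have xy : x - y = x * y.
  by rewrite /x /y Sn; field; rewrite -Sn !gt_eqF.
have x1 : x <= 1 by rewrite invf_le1 // ler1n.
have y1 : y <= 1 by rewrite (le_trans dl) // (le_trans du).
have xx : x ^+ 2 <= 2 * (x * y).
  rewrite expr2 mulrCA ler_wpM2l // /x /y Sn ler_pdivlMr -?Sn // mulrC.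
  rewrite ler_pdivrMr // Sn; have : (1 : R) <= n%:R by rewrite ler1n.
  by lra.
(* From here on, 1/n - 1/(n+1) is written x y with x = 1/n and y = 1/(n+1). *)
rewrite xy; set u := z * d%:C; set E := cexp (- u) - 1 - (- u).
have zy : z / n.+1%:R = z * y%:C by rewrite real_complex_nat -fmorphV.
have -> : gauss_drift z n = z * (y - d)%:C - z * y%:C * u + (1 + z * y%:C) * E.
  rewrite /gauss_drift -/d -/u zy /E rmorphB /= /u; ring.
have uE : cabs u = cabs z * d by rewrite /u cabsM cabs_real ger0_norm.
have u_le : cabs u <= r * x by rewrite uE ler_pM ?cabs_ge0.
have E_le : cabs E <= 2 * (r ^+ 2 * expR r) * (x * y).
  apply: le_trans (cexp_taylor _) _; rewrite cabsN.
  apply: (@le_trans _ _ ((r * x) ^+ 2 * expR r)).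
    rewrite ler_pM ?sqr_ge0 ?expR_ge0 //.
      by rewrite ler_pXn2r ?nnegrE ?cabs_ge0 ?mulr_ge0.
    by rewrite ler_expR (le_trans u_le) // ler_piMr.
  rewrite exprMn mulrAC [2 * _]mulrC -[leRHS]mulrA ler_wpM2l //.
  by rewrite mulr_ge0 ?sqr_ge0 ?expR_ge0.
have t1 : cabs (z * (y - d)%:C) <= r * (x * y).
  rewrite cabsM cabs_real ler_pM ?cabs_ge0 ?normr_ge0 // -xy ler0_norm; lra.
have t2 : cabs (z * y%:C * u) <= r ^+ 2 * (x * y).
  rewrite cabsM [cabs (z * _)]cabsM cabs_real ger0_norm //.
  rewrite (_ : r ^+ 2 * (x * y) = (r * y) * (r * x)); last by ring.
  by rewrite ler_pM ?mulr_ge0 ?cabs_ge0 // ler_wpM2r.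
have t3 : cabs ((1 + z * y%:C) * E) <= (1 + r) * (2 * (r ^+ 2 * expR r) * (x * y)).
  rewrite cabsM ler_pM ?cabs_ge0 // (le_trans (cabsD _ _)) // cabs1 lerD2l.
  rewrite cabsM cabs_real ger0_norm // -[leRHS]mulr1.
  by rewrite ler_pM ?cabs_ge0.
apply: le_trans (cabsD _ _) _; apply: le_trans (lerD (cabsB _ _) (lexx _)) _.
apply: le_trans (lerD (lerD t1 t2) t3) _.
by rewrite /drift_const; lra.
Qed.

(** Uniformity over the disc of radius r is what makes the limit
    continuous. *)
Lemma gauss_rgamma_tail r z K n : cabs z <= r -> (0 < K)%N -> (K <= n)%N ->
  cabs (gauss_rgamma z n - gauss_rgamma z K) <=
  cabs (gauss_rgamma z K) * (expR (drift_const r * K%:R^-1) - 1).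
Proof.
move=> zr K0 Kn; have r0 : 0 <= r by rewrite (le_trans (cabs_ge0 z)).
apply: (@le_trans _ _ (cabs (gauss_rgamma z K) *
    (expR (drift_const r * (K%:R^-1 - n%:R^-1)) - 1))).
  apply: (@product_drift _ (gauss_rgamma z) (gauss_drift z)) => // m Km.
    exact: gauss_rgammaS.
  by apply: gauss_drift_bound => //; exact: leq_trans Km.
rewrite ler_wpM2l ?cabs_ge0 // lerD2r ler_expR ler_wpM2l ?drift_const_ge0 //.
by rewrite gerBl invr_ge0.
Qed.

(** The first Gauss product is z (z + 1). *)
Lemma gauss_rgamma_bound r z n : cabs z <= r -> (0 < n)%N ->
  cabs (gauss_rgamma z n) <= r * (r + 1) * expR (drift_const r).
Proof.
move=> zr n0; have r0 : 0 <= r by rewrite (le_trans (cabs_ge0 z)).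
have := gauss_rgamma_tail zr (ltn0Sn 0) n0; rewrite invr1 mulr1 => h.
apply: (@le_trans _ _ (cabs (gauss_rgamma z 1) * expR (drift_const r))).
  have -> : gauss_rgamma z n = gauss_rgamma z 1 + (gauss_rgamma z n - gauss_rgamma z 1).
    by rewrite subrKC.
  by apply: le_trans (cabsD _ _) _; lra.
rewrite ler_wpM2r ?expR_ge0 // /gauss_rgamma ln1 mulr0 cexp0 mulr1 invr1 mulr1.
rewrite big_ord_recr big_ord1 /= addr0 cabsM ler_pM ?cabs_ge0 //.
by rewrite (le_trans (cabsD _ _)) // cabs1 lerD2r.
Qed.

Lemma drift_small r (e : R) : 0 < e ->
  exists2 K, (0 < K)%N & expR (drift_const r * K%:R^-1) - 1 < e.
Proof.
move=> e0; have /cvgrPdist_lt/(_ e e0)[K _ hK] := cvg_expR_drift (drift_const r).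
exists K.+1 => //; have := hK K (leqnn K); rewrite /= sub0r normrN.
by apply: le_lt_trans; exact: ler_norm.
Qed.

Lemma gauss_rgamma_tends z : ctends \oo (gauss_rgamma z) (crgamma z).
Proof.
suff [a za] : exists a, ctends \oo (gauss_rgamma z) a.
  by rewrite [crgamma z](ctends_lim za).
pose r := cabs z; have r0 : 0 <= r by exact: cabs_ge0.
pose B := r * (r + 1) * expR (drift_const r).
have B0 : 0 <= B by rewrite !mulr_ge0 ?expR_ge0 // addr_ge0.
apply: cauchy_ctends => e e0.
have [K K0 hK] := drift_small r (divr_gt0 e0 (ltr_wpDl B0 ltr01)).
exists K => n Kn; apply: le_trans (gauss_rgamma_tail (lexx _) K0 Kn) _.
have B1 : 0 < B + 1 by rewrite ltr_wpDl.
apply: (@le_trans _ _ ((B + 1) * (e / (B + 1)))); last first.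
  by rewrite mulrC divfK ?gt_eqF.
rewrite ler_pM ?cabs_ge0 //; last exact: ltW.
  rewrite subr_ge0 -expR0 ler_expR mulr_ge0 ?drift_const_ge0 ?invr_ge0 //.
apply: le_trans (gauss_rgamma_bound (lexx _) K0) _.
by rewrite -/r -/B lerDl.
Qed.

Lemma crgamma_tail r z K : cabs z <= r -> (0 < K)%N ->
  cabs (crgamma z - gauss_rgamma z K) <=
  cabs (gauss_rgamma z K) * (expR (drift_const r * K%:R^-1) - 1).
Proof.
move=> zr K0.
have T : ctends \oo (fun n => gauss_rgamma z n - gauss_rgamma z K)
           (crgamma z - gauss_rgamma z K).
  by apply: ctendsB; [exact: gauss_rgamma_tends|exact: ctends_cst].
apply: (closed_cvg (fun x => x <= _)) (cvg_cabs T); first exact: closed_le.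
near=> n; apply: gauss_rgamma_tail => //; near: n; exact: nbhs_infty_ge.
Unshelve. all: by end_near. Qed.

Lemma gauss_rgamma_cont n z : ccont (gauss_rgamma^~ n) z.
Proof.
apply: ccontM.
  apply: ccont_prod => k _; apply: ccontD; [exact: ccont_id|exact: ccont_cst].
have e0 : n`!%:R * cexp (z * (ln n%:R)%:C) != 0.
  by rewrite mulf_neq0 ?cexp_neq0 // pnatr_eq0 -lt0n fact_gt0.
apply: (@ccontV _ (fun w => n`!%:R * cexp (w * (ln n%:R)%:C))) => //.
apply: ccontM; first exact: ccont_cst.
apply: (@ccont_comp _ (fun w => w * (ln n%:R)%:C)); last exact: cexp_cont.
by apply: ccontM; [exact: ccont_id|exact: ccont_cst].
Qed.

(** A uniform limit of continuous functions is continuous. *)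
Lemma crgamma_cont z : ccont (@crgamma R) z.
Proof.
move=> e e0; pose r := cabs z + 1; have r0 : 0 <= r by rewrite addr_ge0 ?cabs_ge0.
pose B := r * (r + 1) * expR (drift_const r).
have B0 : 0 <= B by rewrite !mulr_ge0 ?expR_ge0 // addr_ge0.
have B1 : 0 < B + 1 by rewrite ltr_wpDl.
have e3 : 0 < e / 3 by rewrite divr_gt0.
have [K K0 hK] := drift_small r (divr_gt0 e3 B1).
have [d d0 hd] := @gauss_rgamma_cont K z (e / 3) e3.
have near_lim w : cabs w <= r -> cabs (crgamma w - gauss_rgamma w K) <= e / 3.
  move=> wr; apply: le_trans (crgamma_tail wr K0) _.
  apply: (@le_trans _ _ ((B + 1) * (e / 3 / (B + 1)))); last first.
    by rewrite mulrC divfK ?gt_eqF.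
  rewrite ler_pM ?cabs_ge0 //; last exact: ltW.
    by rewrite subr_ge0 -expR0 ler_expR mulr_ge0 ?drift_const_ge0 ?invr_ge0.
  by apply: le_trans (gauss_rgamma_bound wr K0) _; rewrite -/B lerDl.
exists (Num.min 1 d); first by rewrite lt_min ltr01.
move=> w; rewrite lt_min => /andP[w1 wd].
have wr : cabs w <= r.
  have -> : w = z + (w - z) by rewrite subrKC.
  by apply: le_trans (cabsD _ _) _; rewrite lerD2l ltW.
have zr : cabs z <= r by rewrite lerDl.
have -> : crgamma w - crgamma z = (crgamma w - gauss_rgamma w K) +
    (gauss_rgamma w K - gauss_rgamma z K) - (crgamma z - gauss_rgamma z K) by ring.
have := near_lim w wr; have := near_lim z zr; have := hd w wd => h1 h2 h3.
apply: le_lt_trans (cabsB _ _) _; apply: le_lt_trans (lerD (cabsD _ _) (lexx _)) _.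
lra.
Qed.

(** Take K so large that the limit differs from the K-th Gauss product by less
    than the modulus of that product, which is nonzero. *)
Lemma crgamma_neq0 z : (forall k : nat, z + k%:R != 0) -> crgamma z != 0.
Proof.
move=> zk; have [K K0 hK] := drift_small (cabs z) ltr01.
have PK : gauss_rgamma z K != 0.
  apply: mulf_neq0; first by apply/prodf_neq0 => k _.
  by rewrite invr_eq0 mulf_neq0 ?cexp_neq0.
apply/eqP => cz; have := crgamma_tail (lexx (cabs z)) K0; apply/negP.
rewrite cz sub0r cabsN -ltNge gtr_pMr //.
by rewrite lt_neqAle cabs_ge0 eq_sym cabs_eq0 PK.
Qed.

(** At finite level, z times the n-th Gauss product at z + 1 is the n-th product
    at z times 1 + (z + 1)/n. *)
Lemma crgammaS z : crgamma z = z * crgamma (z + 1).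
Proof.
apply: (@ctends_unique _ _ \oo _
  (fun n => gauss_rgamma z n.+1 * (1 + (z + 1) * (n.+1%:R^-1)%:C))).
  rewrite -[crgamma z]mulr1; apply: ctendsM.
    by have := gauss_rgamma_tends z; rewrite /ctends -cvg_shiftS.
  rewrite -[X in ctends _ _ X]addr0 -(mulr0 (z + 1)).
  apply: ctendsD; first exact: ctends_cst.
  by apply: ctendsM; [exact: ctends_cst|apply: ctends_real; exact: cvg_harmonic].
apply: (@ctends_near _ _ _ _ (fun n => z * gauss_rgamma (z + 1) n.+1)).
  apply: nearW => n; rewrite /gauss_rgamma.
  rewrite [\prod_(k < n.+2) (z + k%:R)]big_ord_recl /= addr0.
  rewrite [\prod_(k < n.+2) (z + 1 + k%:R)]big_ord_recr /=.
  have -> : \prod_(k < n.+1) (z + (bump 0 k)%:R) = \prod_(k < n.+1) (z + 1 + k%:R).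
    by apply: eq_bigr => k _; rewrite -addrA nat1r.
  rewrite mulrDl mul1r cexpD.
  have -> : cexp (ln n.+1%:R)%:C = n.+1%:R :> R[i].
    by rewrite /cexp /= cos0 sin0 lnK ?posrE ?ltr0n // real_complex_nat; simpc.
  have h1 := cexp_neq0 (z * (ln n.+1%:R)%:C).
  have h3 : (n.+1%:R : R[i]) != 0 by rewrite pnatr_eq0.
  have h4 : (n.+1`!%:R : R[i]) != 0 by rewrite pnatr_eq0 -lt0n fact_gt0.
  have -> : (n.+1%:R^-1 : R)%:C = (n.+1%:R : R[i])^-1 by rewrite real_complex_nat fmorphV.
  move: (n.+1%:R : R[i]) h3 => s h3.
  by field; rewrite h1 h3 h4.
apply: ctendsM; first exact: ctends_cst.
by have := gauss_rgamma_tends (z + 1); rewrite /ctends -[in X in X -> _]cvg_shiftS.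
Qed.

Lemma crgamma_near z : near_ccont (@crgamma R) z.
Proof. by exists 1 => // w _; exact: crgamma_cont. Qed.

Lemma cgamma_near z : (forall k : nat, z + k%:R != 0) -> near_ccont (@cgamma R) z.
Proof.
move=> zk; have g0 := crgamma_neq0 zk.
have c0 : 0 < cabs (crgamma z) by rewrite lt_neqAle cabs_ge0 eq_sym cabs_eq0 g0.
have [d d0 hd] := crgamma_cont z c0.
exists d => // w wd; apply: ccontV; last exact: crgamma_cont.
apply: contraTneq (hd w wd) => ->.
by rewrite sub0r cabsN ltxx.
Qed.

Lemma cgammaS z : z != 0 -> cgamma (z + 1) = z * cgamma z.
Proof. by move=> z0; rewrite /cgamma [crgamma z]crgammaS invfM mulVKf. Qed.

End ReciprocalGamma.

(** * Integrals of complex functions over a segment *)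

Section CurveIntegrals.
Variable R : realType.
Implicit Types (f g : R -> R[i]) (k : R[i]).

Definition ccurve f := forall t : R, ctends (nbhs t) f (f t).

Lemma ccurve_cst k : ccurve (fun=> k).
Proof. by move=> t; exact: ctends_cst. Qed.

Lemma ccurveM f g : ccurve f -> ccurve g -> ccurve (fun t => f t * g t).
Proof. by move=> fc gc t; apply: ctendsM. Qed.

Lemma ccurve_sum (I : Type) (s : seq I) (P : pred I) (f : I -> R -> R[i]) :
  (forall l, P l -> ccurve (f l)) -> ccurve (fun t => \sum_(k <- s | P k) f k t).
Proof. by move=> fc t; apply: ctends_sum => k Pk; exact: fc. Qed.

Lemma ccurve_prod (I : Type) (s : seq I) (P : pred I) (f : I -> R -> R[i]) :
  (forall l, P l -> ccurve (f l)) -> ccurve (fun t => \prod_(k <- s | P k) f k t).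
Proof. by move=> fc t; apply: ctends_prod => k Pk; exact: fc. Qed.

Lemma integrable_segment (u : R -> R) (a b : R) : continuous u ->
  (@lebesgue_measure R).-integrable `[a, b] (EFin \o u).
Proof.
move=> uc; apply: continuous_compact_integrable; first exact: segment_compact.
exact: continuous_subspaceT.
Qed.

Lemma ccurve_integrable f a b : ccurve f ->
  (@lebesgue_measure R).-integrable `[a, b] (EFin \o (fun t => complex.Re (f t))) /\
  (@lebesgue_measure R).-integrable `[a, b] (EFin \o (fun t => complex.Im (f t))).
Proof.
by move=> fc; split; apply: integrable_segment => t; have /ctends_cart[] := fc t.
Qed.

Lemma cintegralD a b f g : ccurve f -> ccurve g ->
  cintegral a b (fun t => f t + g t) = cintegral a b f + cintegral a b g.
Proof.
move=> /(ccurve_integrable a b)[fr fi] /(ccurve_integrable a b)[gr gi].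
apply: eq_Re_Im; rewrite ?ReD ?ImD /=.
  by under eq_Rintegral do rewrite ReD; rewrite RintegralD.
by under eq_Rintegral do rewrite ImD; rewrite RintegralD.
Qed.

Lemma cintegralZ a b k f : ccurve f ->
  cintegral a b (fun t => k * f t) = k * cintegral a b f.
Proof.
move=> fc; have [fr fi] := ccurve_integrable a b fc.
have reE z w : complex.Re (z * w : R[i]) =
    complex.Re z * complex.Re w - complex.Im z * complex.Im w.
  by case: z w => ? ? [? ?].
have imE z w : complex.Im (z * w : R[i]) =
    complex.Re z * complex.Im w + complex.Im z * complex.Re w.
  by case: z w => ? ? [? ?].
have iZ (r : R) (u : R -> R) : continuous u ->
    (@lebesgue_measure R).-integrable `[a, b] (EFin \o (fun t => r * u t)).
  by move=> uc; apply: integrable_segment => t; apply: cvgM; [exact: cvg_cst|exact: uc].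
have rc : continuous (fun t => complex.Re (f t)) by move=> t; have /ctends_cart[] := fc t.
have ic : continuous (fun t => complex.Im (f t)) by move=> t; have /ctends_cart[] := fc t.
apply: eq_Re_Im; rewrite ?reE ?imE /=.
  under eq_Rintegral do rewrite reE.
  by rewrite RintegralB ?RintegralZl //; exact: iZ.
under eq_Rintegral do rewrite imE.
by rewrite RintegralD ?RintegralZl //; exact: iZ.
Qed.

Lemma cintegral0 a b : cintegral a b (fun=> 0 : R[i]) = 0.
Proof.
have := cintegralZ a b 0 (ccurve_cst 0).
by rewrite !mul0r.
Qed.

Lemma cintegral_sum a b (I : Type) (s : seq I) (f : I -> R -> R[i]) :
  (forall l, ccurve (f l)) ->
  cintegral a b (fun t => \sum_(k <- s) f k t) = \sum_(k <- s) cintegral a b (f k).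
Proof.
move=> fc; elim: s => [|k s ih].
  by under eq_fun do rewrite big_nil; rewrite big_nil cintegral0.
under eq_fun do rewrite big_cons; rewrite big_cons cintegralD ?ih //.
exact: ccurve_sum.
Qed.

Lemma cabs_cintegral a b f (B : R) : a <= b -> ccurve f ->
  (forall t, cabs (f t) <= B) -> cabs (cintegral a b f) <= B * (b - a) * 2.
Proof.
move=> ab fc fB; have [fr fi] := ccurve_integrable a b fc.
have len : fine (lebesgue_measure (`[a, b]%classic : set R)) = b - a.
  rewrite lebesgue_measure_itv /= lte_fin; move: ab; rewrite le_eqVlt.
  by case/predU1P => [->|->] //; rewrite ltxx subrr.
have bound (u : R -> R) : continuous u -> (forall t, `|u t| <= B) ->
    `|\int[lebesgue_measure]_(t in `[a, b]) u t| <= B * (b - a).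
  move=> uc uB; apply: le_trans (le_normr_Rintegral _ _) _ => //.
    exact: integrable_segment.
  rewrite -len -Rintegral_cst //; apply: le_Rintegral => //.
    apply: (@integrable_segment (fun t => `|u t|)) => t.
    by apply: cvg_norm; exact: uc.
  by apply: (@integrable_segment (fun=> B)) => t; exact: cvg_cst.
rewrite mulr2n mulrDr mulr1 (le_trans (cabs_cart _ _)) // lerD // bound //.
- by move=> t; have /ctends_cart[] := fc t.
- by move=> t; exact: le_trans (ler_Re_cabs _) (fB t).
- by move=> t; have /ctends_cart[] := fc t.
- by move=> t; exact: le_trans (ler_Im_cabs _) (fB t).
Qed.

End CurveIntegrals.

(** * Matrix-valued integrals over circles *)

Section Circles.
Variables (R : realType) (N : nat).
Implicit Types (c z : R[i]) (r t : R) (F G : R[i] -> 'M[R[i]]_N) (X M : 'M[R[i]]_N).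

Lemma circle_dist c r t : 0 <= r -> cabs (circle c r t - c) = r.
Proof.
by move=> r0; rewrite /circle addrC addKr cabsM cabs_real cabs_cexp expR0 mulr1 ger0_norm.
Qed.

Lemma ccurve_circle_exp : ccurve (fun t : R => cexp (0 +i* t)).
Proof.
move=> t; apply: ctends_comp; last exact: cexp_cont.
by apply/ctends_cart; split => /=; [exact: cvg_cst|exact: cvg_id].
Qed.

Lemma ccurve_circle c r : ccurve (circle c r).
Proof.
move=> t; apply: ctendsD; first exact: ctends_cst.
by apply: ccurveM; [exact: ccurve_cst|exact: ccurve_circle_exp].
Qed.

Lemma ccurve_circle_deriv r : ccurve (circle_deriv r).
Proof.
apply: ccurveM; first exact: ccurve_cst.
by apply: ccurveM; [exact: ccurve_cst|exact: ccurve_circle_exp].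
Qed.

Lemma cabs_circle_deriv r t : 0 <= r -> cabs (circle_deriv r t) = r.
Proof.
move=> r0; rewrite /circle_deriv cabsM [cabs (r%:C * _)]cabsM cabs_real cabs_cexp expR0 mulr1 ger0_norm //.
by rewrite cabs_def /= expr0n expr1n add0r sqrtr1 mul1r.
Qed.

Definition continuous_on_circle c r F :=
  forall i j, ccurve (fun t => F (circle c r t) i j).

Lemma eq_circle_integral c r F G :
  (forall t, F (circle c r t) = G (circle c r t)) ->
  circle_integral c r F = circle_integral c r G.
Proof.
move=> FG; apply/matrixP => i j; rewrite !mxE; congr cintegral.
by apply/funext => t; rewrite FG.
Qed.

Lemma circle_integral_shift c a r F :
  circle_integral (c + a) r F = circle_integral c r (fun z => F (z + a)).
Proof.
apply/matrixP => i j; rewrite !mxE; congr cintegral; apply/funext => t.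
by rewrite /circle addrAC.
Qed.

Lemma circle_integralD c r F G :
  continuous_on_circle c r F -> continuous_on_circle c r G ->
  circle_integral c r (fun z => F z + G z) =
  circle_integral c r F + circle_integral c r G.
Proof.
move=> Fc Gc; apply/matrixP => i j; rewrite !mxE -cintegralD.
- by congr cintegral; apply/funext => t; rewrite !mxE mulrDl.
- by apply: ccurveM; [exact: Fc|exact: ccurve_circle_deriv].
- by apply: ccurveM; [exact: Gc|exact: ccurve_circle_deriv].
Qed.

Lemma circle_integral_mull c r F X : continuous_on_circle c r F ->
  circle_integral c r (fun z => X *m F z) = X *m circle_integral c r F.
Proof.
move=> Fc; apply/matrixP => i j; rewrite !mxE.
under [RHS]eq_bigr => k _.
  rewrite mxE -cintegralZ; last first.
    by apply: ccurveM; [exact: Fc|exact: ccurve_circle_deriv].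
  over.
rewrite -cintegral_sum => [|k].
  congr cintegral; apply/funext => t; rewrite mxE mulr_suml.
  by apply: eq_bigr => k _; rewrite mulrA.
apply: ccurveM; first exact: ccurve_cst.
by apply: ccurveM; [exact: Fc|exact: ccurve_circle_deriv].
Qed.

Lemma circle_integral_mulr c r F X : continuous_on_circle c r F ->
  circle_integral c r (fun z => F z *m X) = circle_integral c r F *m X.
Proof.
move=> Fc; apply/matrixP => i j; rewrite !mxE.
under [RHS]eq_bigr => k _.
  rewrite mxE mulrC -cintegralZ; last first.
    by apply: ccurveM; [exact: Fc|exact: ccurve_circle_deriv].
  over.
rewrite -cintegral_sum => [|k].
  congr cintegral; apply/funext => t; rewrite mxE mulr_suml.
  by apply: eq_bigr => k _; rewrite mulrAC mulrC.
apply: ccurveM; first exact: ccurve_cst.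
by apply: ccurveM; [exact: Fc|exact: ccurve_circle_deriv].
Qed.

Lemma cabs_circle_integral c r F (B : R) i j : 0 <= r -> continuous_on_circle c r F ->
  (forall t, cabs (F (circle c r t) i j) <= B) ->
  cabs (circle_integral c r F i j) <= B * r * (2 * pi) * 2.
Proof.
move=> r0 Fc FB; rewrite mxE -[2 * pi in leRHS]subr0; apply: cabs_cintegral.
- by rewrite mulr_ge0 // pi_ge0.
- by apply: ccurveM; [exact: Fc|exact: ccurve_circle_deriv].
- by move=> t; rewrite cabsM cabs_circle_deriv // ler_wpM2r.
Qed.

End Circles.

(** * The holomorphic functional calculus *)

Section FunctionalCalculus.
Variables (R : realType) (N : nat).
Implicit Types (c z : R[i]) (r t : R) (f g : R[i] -> R[i]) (X M : 'M[R[i]]_N).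

Lemma eigenvalueE M c : eigenvalue M c = (c%:M - M \notin unitmx).
Proof.
rewrite /eigenvalue /eigenspace kermx_eq0 row_free_unit -opprB.
by rewrite -scaleN1r unitmxZ ?unitrN1.
Qed.

(** The eigenvalues are the roots of the characteristic polynomial, so the sum
    over the spectrum is finite. *)
Lemma spectrum_seq M : exists2 s : seq R[i], uniq s &
  forall c, eigenvalue M c = (c \in s).
Proof.
have [s sE] := closed_field_poly_normal (char_poly M).
exists (undup s) => [|c]; first exact: undup_uniq.
rewrite mem_undup eigenvalue_root_char sE rootZ ?root_prod_XsubC //.
by rewrite lead_coef_eq0 monic_neq0 ?char_poly_monic.
Qed.

Definition resolvent M z : 'M[R[i]]_N := invmx (z%:M - M).

Lemma resolventE M z : ~~ eigenvalue M z ->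
  z *: resolvent M z = 1%:M + M *m resolvent M z.
Proof.
rewrite eigenvalueE negbK => zM.
rewrite -{1}(mulmxV zM) mulmxBl subrK mul_scalar_mx //.
Qed.

Lemma resolvent_comm X M z : X *m M = M *m X ->
  X *m resolvent M z = resolvent M z *m X.
Proof.
move=> XM; rewrite /resolvent.
have XzM : X *m (z%:M - M) = (z%:M - M) *m X.
  by rewrite mulmxBr mulmxBl XM scalar_mxC.
case: (boolP (z%:M - M \in unitmx)) => [zM|zM]; last by rewrite /invmx (negbTE zM).
by rewrite -[LHS](mulKmx zM) [_ *m (X *m _)]mulmxA -XzM -[X *m _ *m _]mulmxA mulmxV // mulmx1.
Qed.

Lemma det_ccurve n (A : R -> 'M[R[i]]_n) :
  (forall i j, ccurve (fun t => A t i j)) -> ccurve (fun t => \det (A t)).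
Proof.
move=> Ac; apply: ccurve_sum => s _; apply: ccurveM; first exact: ccurve_cst.
by apply: ccurve_prod => k _; exact: Ac.
Qed.

(** The entries of the resolvent are the cofactors divided by the determinant,
    which are polynomials in the entries. *)
Lemma resolvent_curve M (u : R -> R[i]) : ccurve u ->
  (forall t, ~~ eigenvalue M (u t)) ->
  forall i j, ccurve (fun t => resolvent M (u t) i j).
Proof.
move=> uc uM i j.
have entry k l : ccurve (fun t => ((u t)%:M - M) k l).
  move=> t; rewrite !mxE; under [X in ctends _ X]eq_fun do rewrite !mxE.
  apply: ctendsB; last exact: ctends_cst.
  by case: eqP => _; rewrite ?mulr1n ?mulr0n; [exact: uc|exact: ctends_cst].
have det_curve := det_ccurve entry.
have adj_curve : ccurve (fun t => \adj ((u t)%:M - M) i j).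
  under [X in ccurve X]eq_fun do rewrite mxE /cofactor.
  apply: ccurveM; first exact: ccurve_cst.
  apply: det_ccurve => k l.
  by under [X in ccurve X]eq_fun do rewrite 2!mxE; exact: entry.
have -> : (fun t => resolvent M (u t) i j) =
    fun t => (\det ((u t)%:M - M))^-1 * \adj ((u t)%:M - M) i j.
  apply/funext => t; have := uM t; rewrite eigenvalueE negbK => utM.
  by rewrite /resolvent /invmx utM mxE.
apply: ccurveM => // t; apply: ctendsV; last exact: det_curve.
by have := uM t; rewrite eigenvalueE negbK unitmxE unitfE.
Qed.

Definition contour_sum f M (s : seq R[i]) r : 'M[R[i]]_N :=
  ((2 * pi)%:C * (0 +i* 1))^-1 *:
    \sum_(c <- s) circle_integral c r (fun z => f z *: resolvent M z).

Lemma mxfunE f M (s : seq R[i]) : uniq s -> (forall c, eigenvalue M c = (c \in s)) ->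
  mxfun f M = lim (contour_sum f M s r @[r --> (0 : R)^'+]).
Proof.
move=> us sM; rewrite /mxfun;
apply: (congr1 (fun g : R -> 'M[R[i]]_N => lim (g r @[r --> (0 : R)^'+]))).
apply/funext => r; rewrite /contour_sum.
have -> : [set c | eigenvalue M c] = [set` s].
  by apply/seteqP; split => c /=; rewrite sM.
by rewrite -fsbig_seq.
Qed.

Definition spectrum_regular f M := forall c, eigenvalue M c -> near_ccont f c.

Lemma near_all_seq (T : Type) (F : set_system T) {FF : Filter F} (I : eqType)
    (s : seq I) (P : I -> T -> Prop) :
  (forall k, k \in s -> \forall x \near F, P k x) ->
  \forall x \near F, forall k, k \in s -> P k x.
Proof.
elim: s => [|k s ih] Ps; first by apply: nearW.
have Pk := Ps k (mem_head _ _).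
have Ps' : \forall x \near F, forall k, k \in s -> P k x.
  by apply: ih => l ls; apply: Ps; rewrite in_cons ls orbT.
apply: filterS2 Pk Ps' => x Px Pxs l; rewrite in_cons => /predU1P[->//|].
exact: Pxs.
Qed.

(** For small r, the circle of radius r around an eigenvalue c stays in any
    given disc around c, and meets no other eigenvalue because these are finitely
    many. *)
Lemma near_circles (P : R[i] -> Prop) M (s : seq R[i]) :
  (forall c, eigenvalue M c = (c \in s)) ->
  (forall c, eigenvalue M c ->
     exists2 d : R, 0 < d & forall w, cabs (w - c) < d -> P w) ->
  \forall r \near (0 : R)^'+, forall c, c \in s ->
    0 < r /\ forall t, ~~ eigenvalue M (circle c r t) /\ P (circle c r t).
Proof.
move=> sM Ps; apply: near_all_seq => c cs.
have /Ps[d d0 dP] : eigenvalue M c by rewrite sM.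
have far : \forall r \near (0 : R)^'+, forall c', c' \in s ->
    c' != c -> r < cabs (c' - c).
  apply: near_all_seq => c' _; have [->|c'c] := eqVneq c' c.
    by apply: nearW.
  have : 0 < cabs (c' - c) by rewrite lt_neqAle cabs_ge0 eq_sym cabs_eq0 subr_eq0 c'c.
  by move/nbhs_right_lt; apply: filterS.
near=> r; have r0 : 0 < r by near: r; exact: nbhs_right_gt.
split => // t; have ct : cabs (circle c r t - c) = r by rewrite circle_dist // ltW.
split; last by apply: dP; rewrite ct; near: r; exact: nbhs_right_lt.
rewrite sM; apply/negP => cts.
have ctc : circle c r t != c.
  by apply: contraTneq r0 => h; rewrite -ct h subrr cabs0 ltxx.
have : r < cabs (circle c r t - c).
  by move: (circle c r t) cts ctc {ct}; near: r; exact: far.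
by rewrite ct ltxx.
Unshelve. all: by end_near. Qed.

Lemma near_contour_regular f M (s : seq R[i]) : (forall c, eigenvalue M c = (c \in s)) ->
  spectrum_regular f M ->
  \forall r \near (0 : R)^'+, forall c, c \in s ->
    (forall t, ~~ eigenvalue M (circle c r t)) /\
    continuous_on_circle c r (fun z => f z *: resolvent M z) /\
    continuous_on_circle c r (fun z => f z *: (1%:M : 'M[R[i]]_N)).
Proof.
move=> sM fM; have := near_circles sM fM; apply: filterS => r h c /h[r0 ct].
have fc : ccurve (fun t => f (circle c r t)).
  by move=> t; apply: ctends_comp; [exact: ccurve_circle|exact: (ct t).2].
split => [t|]; first by have [] := ct t.
split => i j.
  under [X in ccurve X]eq_fun do rewrite mxE.
  apply: ccurveM => //; apply: resolvent_curve; first exact: ccurve_circle.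
  by move=> t; have [] := ct t.
under [X in ccurve X]eq_fun do rewrite mxE.
by apply: ccurveM => //; exact: ccurve_cst.
Qed.

Lemma lim_near_eq (g h : R -> 'M[R[i]]_N) :
  (\forall r \near (0 : R)^'+, g r = h r) ->
  lim (g r @[r --> (0 : R)^'+]) = lim (h r @[r --> (0 : R)^'+]).
Proof.
move=> gh; apply: (congr1 (@lim _)); apply/seteqP; split => A.
  by apply: filterS2 gh => r /= <-.
by apply: filterS2 gh => r /= ->.
Qed.

(** The value assigned to the limit when there is none is the zero matrix.
    Hence an identity which is linear in the limits also holds when they do not
    exist. *)
Lemma lim_dvg (g : R -> 'M[R[i]]_N) :
  (forall L, ~ mtends (0 : R)^'+ g L) -> lim (g r @[r --> (0 : R)^'+]) = 0.
Proof.
move=> gN; rewrite dvgP; first by apply/matrixP => i j; rewrite !mxE.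
by move=> /cvg_ex[L /mtendsP]; exact: gN.
Qed.

Lemma mxfun_near f g M :
  (forall c, eigenvalue M c ->
     exists2 d : R, 0 < d & forall w, cabs (w - c) < d -> f w = g w) ->
  mxfun f M = mxfun g M.
Proof.
move=> fg; have [s us sM] := spectrum_seq M.
rewrite !(mxfunE _ us sM); apply: lim_near_eq.
have := near_circles sM fg; apply: filterS => r h.
rewrite /contour_sum; congr (_ *: _); rewrite big_seq [RHS]big_seq.
apply: eq_bigr => c /h[_ ct]; apply: eq_circle_integral => t.
by have [_ ->] := ct t.
Qed.

(** The contours for M + a are those for M translated by a, and the resolvent
    of M + a at z + a is the resolvent of M at z. *)
Lemma mxfun_shift f M a : mxfun f (M + a%:M) = mxfun (fun z => f (z + a)) M.
Proof.
have [s us sM] := spectrum_seq M.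
have sMa c : eigenvalue (M + a%:M) c = (c \in [seq w + a | w <- s]).
  rewrite -[c](subrK a) (mem_map (addIr a)) -sM !eigenvalueE.
  by rewrite raddfD /= opprD addrACA subrr addr0.
have usa : uniq [seq w + a | w <- s] by rewrite map_inj_uniq //; exact: addIr.
rewrite (mxfunE _ us sM) (mxfunE _ usa sMa);
apply: (congr1 (fun g : R -> 'M[R[i]]_N => lim (g r @[r --> (0 : R)^'+]))).
apply/funext => r; rewrite /contour_sum big_map.
apply: (congr1 (fun X : 'M[R[i]]_N => ((2 * pi)%:C * (0 +i* 1))^-1 *: X)).
apply: eq_bigr => c _.
rewrite circle_integral_shift; apply: eq_circle_integral => t.
by rewrite /resolvent raddfD /= opprD addrACA subrr addr0.
Qed.

(** X commutes with the resolvent, hence with the contour integrals, hence with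
    their limit. *)
Lemma mxfun_comm f M X : spectrum_regular f M -> X *m M = M *m X ->
  X *m mxfun f M = mxfun f M *m X.
Proof.
move=> fM XM; have [s us sM] := spectrum_seq M; rewrite (mxfunE _ us sM).
have cX : \forall r \near (0 : R)^'+, X *m contour_sum f M s r = contour_sum f M s r *m X.
  have := near_contour_regular sM fM; apply: filterS => r h.
  rewrite /contour_sum -scalemxAl -scalemxAr; congr (_ *: _).
  rewrite mulmx_sumr mulmx_suml big_seq [RHS]big_seq.
  apply: eq_bigr => c /h[ct [fc _]].
  rewrite -circle_integral_mull // -circle_integral_mulr //.
  apply: eq_circle_integral => t.
  by rewrite -scalemxAr -scalemxAl resolvent_comm.
have [[L gL]|gN] := pselect (exists L, mtends (0 : R)^'+ (contour_sum f M s) L).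
  rewrite (mtends_lim gL); apply: (@mtends_unique _ _ (0 : R)^'+ _ _ _
      (fun r => X *m contour_sum f M s r)).
    by apply: mtendsM => //; exact: mtends_cst.
  apply: mtends_near (mtendsM gL (mtends_cst X)).
  by apply: filterS cX => r.
by rewrite lim_dvg ?mulmx0 ?mul0mx // => L gL; apply: gN; exists L.
Qed.

(** The length of the circle tends to 0 and f is bounded near c. *)
Lemma circle_integral_small f c : near_ccont f c ->
  mtends (0 : R)^'+ (fun r => circle_integral c r (fun z => f z *: (1%:M : 'M[R[i]]_N))) 0.
Proof.
move=> [d d0 fd] i j; rewrite mxE.
pose B := cabs (f c) + 1; have B0 : 0 <= B by rewrite addr_ge0 ?cabs_ge0.
have [e e0 fe] : exists2 e : R, 0 < e & forall w, cabs (w - c) < e -> cabs (f w) <= B.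
  have [|e e0 fe] := fd c _ 1 ltr01; first by rewrite subrr cabs0.
  exists e => // w /fe h; have -> : f w = f c + (f w - f c) by rewrite subrKC.
  by apply: le_trans (cabsD _ _) _; rewrite lerD2l ltW.
apply: (@ctends_squeeze _ _ _ _ _ _ (fun r => B * r * (2 * pi) * 2)).
  near=> r; have r0 : 0 < r by near: r; exact: nbhs_right_gt.
  have ct t : cabs (circle c r t - c) = r by rewrite circle_dist // ltW.
  rewrite subr0; apply: cabs_circle_integral; first exact: ltW.
    move=> k l; under [X in ccurve X]eq_fun do rewrite mxE.
    apply: ccurveM; last exact: ccurve_cst.
    move=> t; apply: ctends_comp; first exact: ccurve_circle.
    by apply: fd; rewrite ct; near: r; exact: nbhs_right_lt.
  move=> t; rewrite !mxE cabsM; apply: (@le_trans _ _ (B * 1)); last by rewrite mulr1.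
  rewrite ler_pM ?cabs_ge0 //; last by case: eqP => _; rewrite ?cabs1 ?cabs0.
  by apply: fe; rewrite ct; near: r; exact: nbhs_right_lt.
have id0 : r @[r --> (0 : R)^'+] --> (0 : R) by exact: cvg_within.
have : B * r * (2 * pi) * 2 @[r --> (0 : R)^'+] --> B * 0 * (2 * pi) * 2.
  exact: (cvgM (cvgM (cvgM (cvg_cst B) id0) (cvg_cst (2 * pi))) (cvg_cst (2 : R))).
by rewrite mulr0 !mul0r.
Unshelve. all: by end_near. Qed.

(** By [resolventE], the contour integral for z f(z) is M times the one for f,
    plus the integrals of f itself, which tend to 0. As M is invertible, one
    side converges if and only if the other does. *)
Lemma mxfun_mulid f M : M \in unitmx -> spectrum_regular f M ->
  mxfun (fun z => z * f z) M = M *m mxfun f M.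
Proof.
move=> Mu fM; have [s us sM] := spectrum_seq M.
pose g := contour_sum f M s; pose h := contour_sum (fun z => z * f z) M s.
pose e r : 'M[R[i]]_N := ((2 * pi)%:C * (0 +i* 1))^-1 *:
    \sum_(c <- s | c \in s) circle_integral c r (fun z => f z *: (1%:M : 'M[R[i]]_N)).
have e0 : mtends (0 : R)^'+ e 0.
  have := @mtends_sum _ _ (0 : R)^'+ _ N N _ s (fun c => c \in s)
    (fun c r => circle_integral c r (fun z => f z *: (1%:M : 'M[R[i]]_N))) (fun=> 0).
  rewrite big1 // => S0; rewrite -[X in mtends _ _ X](scaler0 _ ((2 * pi)%:C * (0 +i* 1))^-1).
  apply: mtendsZ; apply: S0 => c cs; apply: circle_integral_small; apply: fM.
  by rewrite sM.
(* e collects the integrals of f over the circles. *)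
have hg : \forall r \near (0 : R)^'+, h r = e r + M *m g r.
  have := near_contour_regular sM fM; apply: filterS => r hr.
  rewrite /h /e /g /contour_sum -scalemxAr -scalerDr; congr (_ *: _).
  rewrite mulmx_sumr big_seq [X in _ + X]big_seq -big_split /=.
  apply: eq_bigr => c /hr[ct [fc f1]].
  rewrite -circle_integral_mull // -circle_integralD //; last first.
    move=> i j t; rewrite mxE; under [X in ctends _ X]eq_fun do rewrite mxE.
    apply: ctends_sum => k _; apply: ctendsM; first exact: ctends_cst.
    exact: fc.
  apply: eq_circle_integral => t.
  by rewrite mulrC -scalerA resolventE // scalerDr scalemxAr.
have hE : mxfun (fun z => z * f z) M = lim (h r @[r --> (0 : R)^'+]).
  exact: mxfunE us sM.
have gE : mxfun f M = lim (g r @[r --> (0 : R)^'+]) by exact: mxfunE us sM.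
rewrite hE gE {hE gE}; clearbody e g h.
have [[L gL]|gN] := pselect (exists L, mtends (0 : R)^'+ g L).
  rewrite (mtends_lim gL); apply: mtends_lim.
  apply: (@mtends_near _ _ _ _ _ _ (fun r => e r + M *m g r)).
    by apply: filterS hg => r /esym.
  rewrite -[X in mtends _ _ X]add0r; apply: mtendsD => //.
  by apply: mtendsM => //; exact: mtends_cst.
rewrite [X in _ = _ *m X]lim_dvg ?mulmx0; last by move=> L gL; apply: gN; exists L.
apply: lim_dvg => L hL; apply: gN; exists (invmx M *m (L - 0)).
apply: (@mtends_near _ _ _ _ _ _ (fun r => invmx M *m (h r - e r))).
  by apply: filterS hg => r ->; rewrite addrC addKr mulKmx.
apply: mtendsM; first exact: mtends_cst.
by apply: mtendsD => //; exact: mtendsN.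
Qed.

End FunctionalCalculus.

(** * Gamma and reciprocal gamma of a matrix *)

Section MatrixGamma.
Variables (R : realType) (N : nat).
Implicit Types M X : 'M[R[i]]_N.

(** If a = -k then M - a I = M + k I would be singular. *)
Lemma eigenvalue_unit M a (k : R[i]) : M + k%:M \in unitmx -> eigenvalue M a -> a + k != 0.
Proof.
move=> Mk; rewrite eigenvalueE; apply: contraNneq => /eqP.
rewrite addr_eq0 => /eqP ->.
by rewrite raddfN /= -opprD -scaleN1r unitmxZ ?unitrN1 // addrC.
Qed.

(** 1/Gamma(z) = z 1/Gamma(z + 1) holds for all z, and shifting the argument by 1
    shifts the matrix by I. *)
Lemma mxrgammaS M : M \in unitmx -> mxrgamma M = M *m mxrgamma (M + 1%:M).
Proof.
move=> Mu; rewrite /mxrgamma (mxfun_shift (@crgamma R) M 1).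
have fM : spectrum_regular (fun z => crgamma (z + 1)) M.
  move=> c _; exists 1 => // w _.
  apply: (@ccont_comp _ (fun z => z + 1)); last exact: crgamma_cont.
  by apply: ccontD; [exact: ccont_id|exact: ccont_cst].
rewrite -(mxfun_mulid Mu fM); apply: (congr1 (fun f => mxfun f M)).
by apply/funext => z; exact: crgammaS.
Qed.

Lemma mxgamma_regular M : (forall k : nat, M + k%:R%:M \in unitmx) ->
  spectrum_regular (@cgamma R) M.
Proof.
by move=> Mk c Mc; apply: cgamma_near => k; exact: eigenvalue_unit (Mk k) Mc.
Qed.

(** Gamma(z + 1) = z Gamma(z) fails at the dummy value for z = 0. As M is
    invertible, 0 is away from the spectrum. *)
Lemma mxgammaS M : (forall k : nat, M + k%:R%:M \in unitmx) ->
  mxgamma (M + 1%:M) = M *m mxgamma M.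
Proof.
move=> Mk; have Mu : M \in unitmx by have := Mk 0%N; rewrite raddf0 addr0.
rewrite /mxgamma (mxfun_shift (@cgamma R) M 1) -(mxfun_mulid Mu (mxgamma_regular Mk)).
apply: mxfun_near => c Mc.
have c0 : c != 0 by have := eigenvalue_unit (Mk 0%N) Mc; rewrite addr0.
exists (cabs c); first by rewrite lt_neqAle cabs_ge0 eq_sym cabs_eq0 c0.
move=> w wc; rewrite cgammaS //; apply: contraTneq wc => ->.
by rewrite sub0r cabsN ltxx.
Qed.

Lemma mxgamma_comm M X : (forall k : nat, M + k%:R%:M \in unitmx) ->
  X *m M = M *m X -> X *m mxgamma M = mxgamma M *m X.
Proof. by move=> Mk; apply: mxfun_comm; exact: mxgamma_regular. Qed.

Lemma mxrgamma_comm M X : X *m M = M *m X -> X *m mxrgamma M = mxrgamma M *m X.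
Proof. by apply: mxfun_comm => c _; exact: crgamma_near. Qed.

End MatrixGamma.

(** * Powers with the principal logarithm *)

Section PrincipalPower.
Variables (R : realType).
Implicit Types z : R[i].

(** This uses cos (acos q) = q and sin (acos q) = sqrt (1 - q^2) = |Im z| / |z|
    for q = Re z / |z|; the sign of the argument matches the sign of Im z. *)
Lemma cexp_clog z : z != 0 -> cexp (clog z) = z.
Proof.
move=> z0; have r0 : 0 < cabs z by rewrite lt_neqAle cabs_ge0 eq_sym cabs_eq0 z0.
rewrite /clog /carg -/(cabs z) /cexp /= lnK ?posrE //.
set q := complex.Re z / cabs z.
have q1 : -1 <= q <= 1.
  rewrite -ler_norml normrM normfV (ger0_norm (ltW r0)) ler_pdivrMr // mul1r.
  exact: ler_Re_cabs.
have imq : Num.sqrt (1 - q ^+ 2) = `|complex.Im z| / cabs z.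
  have -> : 1 - q ^+ 2 = (complex.Im z / cabs z) ^+ 2.
    have : cabs z ^+ 2 = complex.Re z ^+ 2 + complex.Im z ^+ 2.
      by rewrite cabs_def sqr_sqrtr // addr_ge0 ?sqr_ge0.
    move=> h; have y2 : complex.Im z ^+ 2 = cabs z ^+ 2 - complex.Re z ^+ 2.
      by rewrite h addrAC subrr add0r.
    by rewrite /q !expr_div_n y2; field; rewrite gt_eqF.
  by rewrite sqrtr_sqr normrM normfV (ger0_norm (ltW r0)).
have re : cabs z * q = complex.Re z by rewrite mulrC divfK ?gt_eqF.
have im : cabs z * (complex.Im z / cabs z) = complex.Im z by rewrite mulrC divfK ?gt_eqF.
apply: eq_Re_Im; case: ifPn => im0; rewrite /= !mul0r ?subr0 ?addr0.
- by rewrite acosK ?in_itv.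
- by rewrite cosN acosK ?in_itv.
- by rewrite sin_acos // imq ger0_norm.
- by rewrite sinN sin_acos // imq ltr0_norm ?ltNge // mulNr opprK.
Qed.

Lemma mxexp_comm N (X Y : 'M[R[i]]_N) : Y *m X = X *m Y -> Y *m mxexp X = mxexp X *m Y.
Proof.
move=> YX.
have coefC k : Y *m mexp_coeff X k = mexp_coeff X k *m Y.
  rewrite /mexp_coeff -scalemxAr -scalemxAl; congr (_ *: _).
  exact: (commrX k (YX : GRing.comm Y X)).
apply: (@mtends_unique _ _ \oo _ _ _ (fun n => Y *m series (mexp_coeff X) n)).
  by apply: mtendsM; [exact: mtends_cst|exact: mxexp_tends].
apply: (@mtends_near _ _ _ _ _ _ (fun n => series (mexp_coeff X) n *m Y)).
  apply: nearW => n; rewrite /series /= mulmx_sumr mulmx_suml.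
  by apply: eq_bigr => k _; rewrite coefC.
by apply: mtendsM; [exact: mxexp_tends|exact: mtends_cst].
Qed.

Lemma mxcpowS N z (A : 'M[R[i]]_N) : z != 0 -> mxcpow z A = z *: mxcpow z (A - 1%:M).
Proof.
move=> z0; rewrite /mxcpow.
have -> : clog z *: A = (clog z)%:M + clog z *: (A - 1%:M).
  by rewrite scalerBr scale_scalar_mx mulr1 subrKC.
rewrite mxexpD ?mxexp_scalar ?cexp_clog ?mul_scalar_mx //.
by rewrite /GRing.comm -!mulmxE scalar_mxC.
Qed.

End PrincipalPower.

(** * Pochhammer symbols and terminating hypergeometric sums *)

Section Hypergeometric.
Variables (R : realType) (N : nat).
Implicit Types (M Q S : 'M[R[i]]_N) (a w : R[i]).

Definition cpoch a k : R[i] := \prod_(i < k) (a + i%:R).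

Lemma cpochS a k : cpoch a k.+1 = a * cpoch (a + 1) k.
Proof.
rewrite /cpoch big_ord_recl addr0; congr (_ * _).
by apply: eq_bigr => i _; rewrite -addrA nat1r.
Qed.

Lemma cpochSr a k : cpoch a k.+1 = cpoch a k * (a + k%:R).
Proof. by rewrite /cpoch big_ord_recr. Qed.

Lemma mxpochS M k : mxpoch M k.+1 = M *m mxpoch (M + 1%:M) k.
Proof.
rewrite /mxpoch big_ord_recl /= raddf0 addr0; congr (_ *m _).
by apply: eq_bigr => i _; rewrite -addrA -raddfD /= nat1r.
Qed.

Lemma mxpochSr M k : mxpoch M k.+1 = mxpoch M k *m (M + k%:R%:M).
Proof. by rewrite /mxpoch big_ord_recr. Qed.

Lemma mxpoch_scalar a k : mxpoch (a%:M : 'M[R[i]]_N) k = (cpoch a k)%:M.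
Proof.
elim: k => [|k ih]; first by rewrite /mxpoch /cpoch !big_ord0.
by rewrite mxpochSr cpochSr ih -raddfD -scalar_mxM.
Qed.

Lemma mxpoch_unit M k : (forall s : nat, M + s%:R%:M \in unitmx) -> mxpoch M k \in unitmx.
Proof.
move=> Mu; elim: k => [|k ih]; first by rewrite /mxpoch big_ord0 unitmx1.
by rewrite mxpochSr unitmx_mul ih Mu.
Qed.

Lemma cpoch_neg0 n k : (n < k)%N -> cpoch (- n%:R) k = 0.
Proof.
by move=> nk; rewrite /cpoch (bigD1 (Ordinal nk)) //= addNr mul0r.
Qed.

(** The scalar part of the k-th term of the series 1F2 with numerator
    parameter - n. *)
Definition hyp_coeff n w k : R[i] := w ^+ k / k`!%:R * cpoch (- n%:R) k.

(** The series terminates because (- n)_k = 0 for k > n. The upper bound m is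
    free so that sums for n and n - 1 can be given the same length. *)
Lemma hyp1F2_sum n m Q S w : (n < m)%N ->
  hyp1F2 (- n%:R%:M) Q S w = \sum_(0 <= k < m)
    hyp_coeff n w k *: (invmx (mxpoch Q k) *m invmx (mxpoch S k)).
Proof.
move=> nm; apply: (@mtends_lim _ _ \oo).
apply: mtends_near (mtends_cst _); near=> p.
have mp : (m <= p)%N by near: p; exact: nbhs_infty_ge.
have termE k : (w ^+ k / k`!%:R) *: (mxpoch (- n%:R%:M) k *m invmx (mxpoch Q k)
     *m invmx (mxpoch S k)) =
    hyp_coeff n w k *: (invmx (mxpoch Q k) *m invmx (mxpoch S k)).
  by rewrite -raddfN mxpoch_scalar mul_scalar_mx -scalemxAl scalerA.
rewrite /series /= (eq_bigr _ (fun k _ => termE k)) (@big_cat_nat _ _ _ m 0 p) //=.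
rewrite [X in _ = _ + X]big1_seq ?addr0 // => k /=.
rewrite mem_index_iota => /andP[mk _].
by rewrite /hyp_coeff cpoch_neg0 ?mulr0 ?scale0r // (leq_trans nm).
Unshelve. all: by end_near. Qed.

(** Both sides are -(- (n+1))_(k+1), expanded at its last and at its first
    factor. *)
Lemma cpoch_contiguous n k :
  (n.+1%:R - k%:R) * cpoch (- n.+1%:R) k = n.+1%:R * cpoch (- n%:R) k.
Proof.
have := cpochS (- n.+1%:R) k; rewrite cpochSr.
have -> : - n.+1%:R + 1 = - n%:R :> R[i] by rewrite -natr1 opprD subrK.
by move=> h; rewrite -opprB mulNr mulrC addrC h mulNr opprK.
Qed.

Lemma fact_ratio n : n.+1%:R * (n.+1`!%:R)^-1 = (n`!%:R)^-1 :> R[i].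
Proof. by rewrite factS natrM invfM mulVKf ?pnatr_eq0. Qed.

(** Since Q + (n+1) = (Q + k) + (n+1 - k), the first part gives the sum over V
    and the second one, by [cpoch_contiguous], the sum for n. It applies with U k
    and V k the products of inverse Pochhammer symbols, where one of the two
    arguments is Q + I in U and Q in V. *)
Lemma hyp_sum_contiguous n w Q (U V : nat -> 'M[R[i]]_N) p :
  (forall k, Q *m V k = (Q + k%:R%:M) *m U k) ->
  (n.+1`!%:R)^-1 *: ((Q + n.+1%:R%:M) *m
      \sum_(0 <= k < p) hyp_coeff n.+1 w k *: U k) =
  (n`!%:R)^-1 *: (\sum_(0 <= k < p) hyp_coeff n w k *: U k) +
  (n.+1`!%:R)^-1 *: (Q *m \sum_(0 <= k < p) hyp_coeff n.+1 w k *: V k).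
Proof.
move=> QV; rewrite !mulmx_sumr !scaler_sumr -big_split /=; apply: eq_bigr => k _.
rewrite -!scalemxAr QV.
have -> : (Q + n.+1%:R%:M) *m U k =
    (n.+1%:R - k%:R) *: U k + (Q + k%:R%:M) *m U k.
  rewrite -mul_scalar_mx -mulmxDl raddfB /=; congr (_ *m _).
  by rewrite [RHS]addrC addrA addrAC addrK.
rewrite !scalerDr; congr (_ + _); rewrite !scalerA; congr (_ *: _).
rewrite -(fact_ratio n) /hyp_coeff -!mulrA [cpoch _ _ * _]mulrC cpoch_contiguous.
by ring.
Qed.

Lemma hyp_coeffS n w k :
  k.+1%:R * hyp_coeff n.+1 w k.+1 = - (n.+1%:R * w * hyp_coeff n w k).
Proof.
rewrite /hyp_coeff cpochS exprS -(fact_ratio k).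
have -> : - n.+1%:R + 1 = - n%:R :> R[i] by rewrite -natr1 opprD subrK.
by ring.
Qed.

(** The difference Q - (Q + k) = - k cancels the term k = 0 and turns the
    coefficient of index k + 1 for n + 1 into the one of index k for n, times
    w. *)
Lemma hyp_sum_shift n w Q (U V : nat -> 'M[R[i]]_N) p :
  (forall k, Q *m V k = (Q + k%:R%:M) *m U k) ->
  (n.+1`!%:R)^-1 *: (Q *m \sum_(0 <= k < p.+1) hyp_coeff n.+1 w k *: U k) =
  (n.+1`!%:R)^-1 *: (Q *m \sum_(0 <= k < p.+1) hyp_coeff n.+1 w k *: V k) +
  w *: ((n`!%:R)^-1 *: \sum_(0 <= k < p) hyp_coeff n w k *: U k.+1).
Proof.
move=> QV.
have -> : Q *m (\sum_(0 <= k < p.+1) hyp_coeff n.+1 w k *: V k) =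
    Q *m (\sum_(0 <= k < p.+1) hyp_coeff n.+1 w k *: U k) +
    \sum_(0 <= k < p.+1) (k%:R * hyp_coeff n.+1 w k) *: U k.
  rewrite !mulmx_sumr -big_split /=; apply: eq_bigr => k _.
  by rewrite -!scalemxAr QV mulmxDl mul_scalar_mx scalerDr scalerA [_ * k%:R]mulrC.
rewrite scalerDr -addrA -[LHS]addr0; congr (_ + _); apply/esym.
rewrite big_nat_recl // mul0r scale0r add0r !scaler_sumr -big_split /= big1 // => k _.
rewrite hyp_coeffS !scalerA -scalerDl -(fact_ratio n).
by rewrite (_ : _ + _ = 0) ?scale0r //; ring.
Qed.

Lemma mxpoch_comm M k : M *m mxpoch M k = mxpoch M k *m M.
Proof.
apply: (@commr_prod _ _ _ _ _ M) => i _; apply: commrD => //.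
by rewrite /GRing.comm -!mulmxE scalar_mxC.
Qed.

Lemma invmx_comm (X Y : 'M[R[i]]_N) : Y *m X = X *m Y -> Y *m invmx X = invmx X *m Y.
Proof.
move=> YX; have [Xu|Xn] := boolP (X \in unitmx); last by rewrite /invmx (negbTE Xn).
by rewrite -[LHS](mulKmx Xu) [X *m (Y *m _)]mulmxA -YX -[Y *m X *m _]mulmxA mulmxV // mulmx1.
Qed.

(** Both sides come from the two expansions M (M + I)_k = (M)_k (M + k I) of
    (M)_(k+1). *)
Lemma inv_mxpoch_contiguous M k : (forall s : nat, M + s%:R%:M \in unitmx) ->
  M *m invmx (mxpoch M k) = (M + k%:R%:M) *m invmx (mxpoch (M + 1%:M) k).
Proof.
move=> Mu; have pu := mxpoch_unit k Mu.
have p1u : mxpoch (M + 1%:M) k \in unitmx.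
  by apply: mxpoch_unit => s; rewrite -addrA -raddfD /= nat1r.
have := mxpochS M k; rewrite mxpochSr => /(congr1 (mulmx (invmx (mxpoch M k)))).
rewrite mulKmx // mulmxA => ->.
by rewrite mulmxK // invmx_comm // mxpoch_comm.
Qed.

Lemma inv_mxpochS M k : (forall s : nat, M + s%:R%:M \in unitmx) ->
  M *m invmx (mxpoch M k.+1) = invmx (mxpoch (M + 1%:M) k).
Proof.
move=> Mu; have pu := mxpoch_unit k.+1 Mu.
have p1u : mxpoch (M + 1%:M) k \in unitmx.
  by apply: mxpoch_unit => s; rewrite -addrA -raddfD /= nat1r.
have c1 : M *m mxpoch (M + 1%:M) k = mxpoch (M + 1%:M) k *m M.
  have := mxpoch_comm (M + 1%:M) k.
  by rewrite mulmxDl mulmxDr mul1mx mulmx1 => /addIr.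
by rewrite -[RHS](mulmxK pu) mxpochS {2}c1 mulKmx.
Qed.

End Hypergeometric.

(** * The bicommutant of two matrices *)

Section Bicommutant.
Variables (R : realType) (N : nat) (A B : 'M[R[i]]_N).
Implicit Types X Y : 'M[R[i]]_N.

(** The matrices that commute with everything that commutes with A and B. If A
    and B commute, any two of them commute. *)
Definition bicommutant X := forall Y, Y *m A = A *m Y -> Y *m B = B *m Y ->
  Y *m X = X *m Y.

Lemma bicommutantD X Y : bicommutant X -> bicommutant Y -> bicommutant (X + Y).
Proof. by move=> hX hY Z ZA ZB; rewrite mulmxDr mulmxDl hX ?hY. Qed.

Lemma bicommutantM X Y : bicommutant X -> bicommutant Y -> bicommutant (X *m Y).
Proof. by move=> hX hY Z ZA ZB; rewrite mulmxA hX // -mulmxA hY // mulmxA. Qed.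

Lemma bicommutantZ a X : bicommutant X -> bicommutant (a *: X).
Proof. by move=> hX Z ZA ZB; rewrite -scalemxAr -scalemxAl hX. Qed.

Lemma bicommutant_scalar a : bicommutant a%:M.
Proof. by move=> Z _ _; rewrite scalar_mxC. Qed.

Lemma bicommutant_fst : bicommutant A. Proof. by move=> Y. Qed.

Lemma bicommutant_snd : bicommutant B. Proof. by move=> Y. Qed.

Lemma bicommutant_inv_mxpoch X k : bicommutant X -> bicommutant (invmx (mxpoch X k)).
Proof.
move=> hX Z ZA ZB; apply: invmx_comm.
apply: (@commr_prod _ _ _ _ _ Z) => i _; apply: commrD; first exact: hX.
by rewrite /GRing.comm -!mulmxE scalar_mxC.
Qed.

Lemma bicommutant_mxgamma X : (forall s : nat, X + s%:R%:M \in unitmx) ->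
  bicommutant X -> bicommutant (mxgamma X).
Proof. by move=> Xu hX Z ZA ZB; apply: mxgamma_comm => //; exact: hX. Qed.

Lemma bicommutant_mxrgamma X : bicommutant X -> bicommutant (mxrgamma X).
Proof. by move=> hX Z ZA ZB; apply: mxrgamma_comm; exact: hX. Qed.

Lemma bicommutant_mxcpow z X : bicommutant X -> bicommutant (mxcpow z X).
Proof. by move=> hX Z ZA ZB; apply: mxexp_comm; exact: (bicommutantZ _ hX). Qed.

Lemma bicommutant_comm X Y : A *m B = B *m A ->
  bicommutant X -> bicommutant Y -> X *m Y = Y *m X.
Proof.
move=> AB hX hY; apply: hY.
  by apply/esym/hX.
by apply/esym/hX.
Qed.

End Bicommutant.

(** * The recurrences of the Bateman matrix polynomials *)

Section Assembly.
Variables (R : realType) (N : nat).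
Implicit Types (A B C D G X : 'M[R[i]]_N) (z : R[i]).

(** The hypergeometric factor, with A and D in place of A + I and
    (1/2) A + B + I. *)
Definition bateman_sum n m A D z : 'M[R[i]]_N := \sum_(0 <= k < m)
  hyp_coeff n (z ^+ 2) k *: (invmx (mxpoch A k) *m invmx (mxpoch D k)).

(** The parameter D stands for (1/2) A + B + I, which is all that a Bateman
    polynomial sees of B; in each recurrence the three values of D differ by
    integers. *)
Lemma batemanE n m A B A1 D z : A1 = A + 1%:M -> D = 2^-1 *: A + B + 1%:M ->
  (n < m)%N -> bateman n A B z = (n`!%:R)^-1 *:
    (mxgamma (D + n%:R%:M) *m mxrgamma A1 *m mxrgamma D *m mxcpow z A *m
     bateman_sum n m A1 D z).
Proof.
move=> -> -> nm; rewrite /bateman (hyp1F2_sum _ _ _ nm) -!scalemxAl.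
by rewrite [B + _]addrC addrAC.
Qed.

Lemma unit_shifts_nat X : (forall s : nat, X + s%:R%:M \in unitmx) ->
  forall k s : nat, X + k%:R%:M + s%:R%:M \in unitmx.
Proof. by move=> Xu k s; rewrite -addrA -raddfD /= -natrD. Qed.

Lemma unit_shiftsS X : (forall s : nat, X + s%:R%:M \in unitmx) ->
  forall s : nat, X + 1%:M + s%:R%:M \in unitmx.
Proof. by move=> Xu s; have := unit_shifts_nat Xu 1 s. Qed.

Lemma unit_shifts_unit X : (forall s : nat, X + s%:R%:M \in unitmx) -> X \in unitmx.
Proof. by move=> /(_ 0%N); rewrite raddf0 addr0. Qed.

Lemma mulmx_pull3 X G1 G2 G3 G4 (H : 'M[R[i]]_N) :
  X *m G3 = G3 *m X -> X *m G4 = G4 *m X ->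
  G1 *m G2 *m (X *m G3) *m G4 *m H = G1 *m G2 *m G3 *m G4 *m (X *m H).
Proof. by move=> h3 h4; rewrite h3 !mulmxA -(mulmxA _ X G4) h4 !mulmxA. Qed.

Lemma mulmx_pull2 X G1 G2 G3 G4 (H : 'M[R[i]]_N) :
  X *m G2 = G2 *m X -> X *m G3 = G3 *m X -> X *m G4 = G4 *m X ->
  G1 *m (X *m G2) *m G3 *m G4 *m H = G1 *m G2 *m G3 *m G4 *m (X *m H).
Proof. by move=> h2 h3 h4; rewrite h2 mulmxA -(mulmxA _ X G3) mulmx_pull3. Qed.

Lemma mulmx_pull1 X G1 G2 G3 G4 (H : 'M[R[i]]_N) :
  X *m G1 = G1 *m X -> X *m G2 = G2 *m X -> X *m G3 = G3 *m X -> X *m G4 = G4 *m X ->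
  X *m G1 *m G2 *m G3 *m G4 *m H = G1 *m G2 *m G3 *m G4 *m (X *m H).
Proof. by move=> h1 h2 h3 h4; rewrite h1 -(mulmxA _ X G2) mulmx_pull2. Qed.

Lemma mulmx_pull X G1 G2 G3 G4 (H : 'M[R[i]]_N) (s : R[i]) :
  X *m G1 = G1 *m X -> X *m G2 = G2 *m X -> X *m G3 = G3 *m X -> X *m G4 = G4 *m X ->
  X *m (s *: (G1 *m G2 *m G3 *m G4 *m H)) = s *: (G1 *m G2 *m G3 *m G4 *m (X *m H)).
Proof.
by move=> h1 h2 h3 h4; rewrite -mulmx_pull1 // -scalemxAr !mulmxA.
Qed.

Lemma scale_mulmxl (L P Q S : 'M[R[i]]_N) (u v w : R[i]) :
  u *: P = v *: Q + w *: S -> u *: (L *m P) = v *: (L *m Q) + w *: (L *m S).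
Proof. by move=> h; rewrite !scalemxAr -mulmxDr h. Qed.

Lemma addn_scalar X n : X + n.+1%:R%:M = X + n%:R%:M + 1%:M.
Proof. by rewrite -addrA -raddfD /= natr1. Qed.

(** Here D is C + I, C + I and C, and the common factor is
    Gamma(C + (n+1) I) Gamma^-1(A + I) Gamma^-1(C + I) z^A. *)
Lemma bateman_lower_snd A B n z : A *m B = B *m A ->
  bateman_defined A B -> bateman_defined A (B - 1%:M) ->
  bateman n.+1 A B z = bateman n A B z + bateman n.+1 A (B - 1%:M) z.
Proof.
move=> AB dAB dABm; pose C := 2^-1 *: A + B.
have Au s : A + 1%:M + s%:R%:M \in unitmx by have [] := dAB s.
have Cu s : C + s%:R%:M \in unitmx.
  have [_] := dABm s; congr (_ \in unitmx); congr (_ + _).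
  by rewrite addrA subrK.
have inK := bicommutant_comm AB.
have kA : bicommutant A B (A + 1%:M).
  by apply: bicommutantD; [exact: bicommutant_fst|exact: bicommutant_scalar].
have kC : bicommutant A B C.
  by apply: bicommutantD; [exact/bicommutantZ/bicommutant_fst|exact: bicommutant_snd].
have kCs a : bicommutant A B (C + a%:M).
  by apply: bicommutantD => //; exact: bicommutant_scalar.
rewrite (@batemanE _ n.+2 A B (A + 1%:M) (C + 1%:M)) //.
rewrite (@batemanE n n.+2 A B (A + 1%:M) (C + 1%:M)) // ?leqnSn //.
rewrite (@batemanE _ n.+2 A (B - 1%:M) (A + 1%:M) C) //; last first.
  by rewrite addrA subrK.
rewrite (mxrgammaS (unit_shifts_unit Cu)).
have -> : C + 1%:M + n.+1%:R%:M = C + n.+1%:R%:M + 1%:M by rewrite addrAC.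
have -> : C + 1%:M + n%:R%:M = C + n.+1%:R%:M by rewrite addrAC -addn_scalar.
have Cnu := unit_shifts_nat Cu n.+1.
rewrite (mxgammaS Cnu).
set X := C + n.+1%:R%:M; set G := mxgamma X; set a := mxrgamma (A + 1%:M).
set c := mxrgamma (C + 1%:M); set Z := mxcpow z A.
have kX : bicommutant A B X by exact: kCs.
have kG : bicommutant A B G by exact: bicommutant_mxgamma.
have ka : bicommutant A B a by exact: bicommutant_mxrgamma.
have kc : bicommutant A B c by exact: bicommutant_mxrgamma.
have kZ : bicommutant A B Z by apply: bicommutant_mxcpow; exact: bicommutant_fst.
set H := bateman_sum n.+1 _ _ (C + 1%:M) z; set H' := bateman_sum n _ _ _ z.
set H'' := bateman_sum n.+1 _ _ C z.
have core : (n.+1)`!%:R^-1 *: (X *m H) = n`!%:R^-1 *: H' + (n.+1)`!%:R^-1 *: (C *m H'').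
  apply: hyp_sum_contiguous => k.
  rewrite mulmxA (inK C) //; last exact: bicommutant_inv_mxpoch.
  rewrite -mulmxA (inv_mxpoch_contiguous _ Cu) !mulmxA; congr (_ *m _).
  by apply: inK; [exact: bicommutant_inv_mxpoch|exact: kCs].
clearbody H H' H''.
have -> : X *m G *m a *m c *m Z *m H = G *m a *m c *m Z *m (X *m H).
  by apply: mulmx_pull1; exact: inK.
have -> : G *m a *m (C *m c) *m Z *m H'' = G *m a *m c *m Z *m (C *m H'').
  by apply: mulmx_pull3; exact: inK.
exact: (scale_mulmxl _ core).
Qed.

Lemma scale_mulmx_power (z s : R[i]) (P Z Z' H : 'M[R[i]]_N) : Z = z *: Z' ->
  z *: (s *: (P *m Z' *m H)) = s *: (P *m Z *m H).
Proof. by move=> ->; rewrite scalerA mulrC -scalerA -scalemxAr -scalemxAl. Qed.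

(** The three terms have the same D, and the common factor is
    Gamma(D + (n+1) I) Gamma^-1(A + I) Gamma^-1(D) z^A. *)
Lemma bateman_lower_fst A B n z : A *m B = B *m A -> z != 0 ->
  bateman_defined A B -> bateman_defined (A - 1%:M) (B + (2^-1)%:M) ->
  (A + n.+1%:R%:M) *m bateman n.+1 A B z =
  (n.+1%:R%:M + B + 2^-1 *: A) *m bateman n A B z +
  z *: bateman n.+1 (A - 1%:M) (B + (2^-1)%:M) z.
Proof.
move=> AB z0 dAB dAm; pose D := 2^-1 *: A + B + 1%:M.
have Au s : A + s%:R%:M \in unitmx by have [] := dAm s; rewrite subrK.
have Du s : D + s%:R%:M \in unitmx by have [] := dAB s.
have kA : bicommutant A B A by exact: bicommutant_fst.
have kAs a : bicommutant A B (A + a%:M).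
  by apply: bicommutantD => //; exact: bicommutant_scalar.
have kD : bicommutant A B D.
  apply: bicommutantD; last exact: bicommutant_scalar.
  by apply: bicommutantD; [exact/bicommutantZ|exact: bicommutant_snd].
have kDs a : bicommutant A B (D + a%:M).
  by apply: bicommutantD => //; exact: bicommutant_scalar.
have inK := bicommutant_comm AB.
rewrite (@batemanE _ n.+2 A B (A + 1%:M) D) //.
rewrite (@batemanE n n.+2 A B (A + 1%:M) D) // ?leqnSn //.
rewrite (@batemanE _ n.+2 (A - 1%:M) (B + (2^-1)%:M) A D) //; last first.
- by rewrite scalerBr scale_scalar_mx mulr1 addrACA addNr addr0.
- by rewrite subrK.
rewrite (scale_mulmx_power _ _ _ (mxcpowS A z0)).
have -> : n.+1%:R%:M + B + 2^-1 *: A = D + n%:R%:M.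
  by rewrite /D -[RHS]addrA -raddfD /= nat1r [2^-1 *: A + B]addrC [RHS]addrC addrA.
rewrite (mxrgammaS (unit_shifts_unit Au)).
have -> : mxgamma (D + n.+1%:R%:M) = (D + n%:R%:M) *m mxgamma (D + n%:R%:M).
  by rewrite addn_scalar (mxgammaS (unit_shifts_nat Du n)).
set X := D + n%:R%:M; set G := mxgamma X; set a := mxrgamma (A + 1%:M).
set c := mxrgamma D; set Z := mxcpow z A.
have kX : bicommutant A B X by exact: kDs.
have kG : bicommutant A B G by apply: bicommutant_mxgamma => //; exact: unit_shifts_nat.
have kXG : bicommutant A B (X *m G) by exact: bicommutantM.
have ka : bicommutant A B a by exact: bicommutant_mxrgamma.
have kc : bicommutant A B c by exact: bicommutant_mxrgamma.
have kZ : bicommutant A B Z by exact: bicommutant_mxcpow.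
clearbody X G a c Z.
set H := bateman_sum n.+1 _ (A + 1%:M) D z; set H' := bateman_sum n _ _ _ z.
set H'' := bateman_sum n.+1 _ A D z.
have core : (n.+1)`!%:R^-1 *: ((A + n.+1%:R%:M) *m H) =
    n`!%:R^-1 *: H' + (n.+1)`!%:R^-1 *: (A *m H'').
  apply: hyp_sum_contiguous => k.
  by rewrite mulmxA (inv_mxpoch_contiguous _ Au) mulmxA.
clearbody H H' H''.
have -> : (A + n.+1%:R%:M) *m ((n.+1)`!%:R^-1 *: (X *m G *m a *m c *m Z *m H)) =
    (n.+1)`!%:R^-1 *: (X *m G *m a *m c *m Z *m ((A + n.+1%:R%:M) *m H)).
  by apply: mulmx_pull; apply: inK => //; exact: kAs.
have -> : X *m (n`!%:R^-1 *: (G *m a *m c *m Z *m H')) =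
    n`!%:R^-1 *: (X *m G *m a *m c *m Z *m H') by rewrite -scalemxAr !mulmxA.
rewrite [T in _ = _ + _ *: T](mulmx_pull2 (X *m G) H'' (inK _ _ kA ka)
  (inK _ _ kA kc) (inK _ _ kA kZ)).
exact: (scale_mulmxl _ core).
Qed.

(** The values of D are D, D and D + I. The reciprocal gammas at A + I and D are
    written with the ones at A + 2 I and D + I, and the factors A + I and D set free in
    this way cancel the first factors of the Pochhammer symbols of index
    k + 1. *)
Lemma bateman_neighbours_fst A B n z : A *m B = B *m A -> z != 0 ->
  bateman_defined A (B - (2^-1)%:M) -> bateman_defined (A - 1%:M) B ->
  A *m bateman n.+1 A (B - (2^-1)%:M) z =
  z *: bateman n.+1 (A - 1%:M) B z + z *: bateman n (A + 1%:M) B z.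
Proof.
move=> AB z0 dA dAm; pose D := 2^-1 *: A + (B - (2^-1)%:M) + 1%:M.
have half : (2^-1 : R[i]) + 2^-1 = 1 by field.
have Au s : A + s%:R%:M \in unitmx by have [] := dAm s; rewrite subrK.
have Du s : D + s%:R%:M \in unitmx by have [] := dA s.
have kA : bicommutant A B A by exact: bicommutant_fst.
have kAs a : bicommutant A B (A + a%:M).
  by apply: bicommutantD => //; exact: bicommutant_scalar.
have kD : bicommutant A B D.
  apply: bicommutantD; last exact: bicommutant_scalar.
  apply: bicommutantD; first exact: bicommutantZ.
  rewrite -raddfN; apply: bicommutantD; first exact: bicommutant_snd.
  exact: bicommutant_scalar.
have kDs a : bicommutant A B (D + a%:M).
  by apply: bicommutantD => //; exact: bicommutant_scalar.
have inK := bicommutant_comm AB.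
rewrite (@batemanE _ n.+2 A _ (A + 1%:M) D) //.
rewrite (@batemanE _ n.+2 (A - 1%:M) B A D) //; last first.
- by rewrite scalerBr scale_scalar_mx mulr1 /D; congr (_ + 1%:M); rewrite addrA addrAC.
- by rewrite subrK.
rewrite (@batemanE n n.+1 (A + 1%:M) B (A + 1%:M + 1%:M) (D + 1%:M)) //; last first.
  have h1 : 1%:M = (2^-1)%:M + (2^-1)%:M :> 'M[R[i]]_N by rewrite -raddfD half.
  rewrite scalerDr scale_scalar_mx mulr1 /D; congr (_ + 1%:M).
  by rewrite -[LHS]addrA -[RHS]addrA; congr (_ + _); rewrite h1 addrA subrK addrC.
rewrite [T in _ = T + _](scale_mulmx_power _ _ _ (mxcpowS A z0)).
have -> : mxcpow z (A + 1%:M) = z *: mxcpow z A by rewrite (mxcpowS _ z0) addrK.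
have -> : D + 1%:M + n%:R%:M = D + n.+1%:R%:M by rewrite addrAC -addn_scalar.
rewrite (mxrgammaS (unit_shifts_unit Au)).
have A1u := unit_shiftsS Au.
rewrite (mxrgammaS (unit_shifts_unit A1u)) (mxrgammaS (unit_shifts_unit Du)).
set G := mxgamma _; set a := mxrgamma _; set c := mxrgamma _; set Z := mxcpow z A.
have kG : bicommutant A B G by apply: bicommutant_mxgamma => //; exact: unit_shifts_nat.
have ka : bicommutant A B a.
  by apply: bicommutant_mxrgamma; apply: bicommutantD => //; exact: bicommutant_scalar.
have kc : bicommutant A B c by apply: bicommutant_mxrgamma; exact: kDs.
have kZ : bicommutant A B Z by exact: bicommutant_mxcpow.
have kA1 := kAs 1.
clearbody G a c Z.
pose L := G *m ((A + 1%:M) *m a) *m (D *m c) *m Z.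
set H := bateman_sum n.+1 _ (A + 1%:M) D z; set H'' := bateman_sum n.+1 _ A D z.
set S := bateman_sum n _ _ _ z.
pose S' := \sum_(0 <= k < n.+1) hyp_coeff n (z ^+ 2) k *:
  (invmx (mxpoch (A + 1%:M) k.+1) *m invmx (mxpoch D k.+1)).
have core : (n.+1)`!%:R^-1 *: (A *m H) =
    (n.+1)`!%:R^-1 *: (A *m H'') + z ^+ 2 *: (n`!%:R^-1 *: S').
  apply: hyp_sum_shift => k.
  by rewrite mulmxA (inv_mxpoch_contiguous _ Au) mulmxA.
(* The sum for n at A + 2 I and D + I, against the shifted sum at A + I and D. *)
have SS' : S = D *m ((A + 1%:M) *m S').
  rewrite !mulmx_sumr; apply: eq_bigr => k _; rewrite -!scalemxAr; congr (_ *: _).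
  rewrite [(A + 1%:M) *m _]mulmxA (inv_mxpochS _ A1u) mulmxA (inK D) //; last first.
    by apply: bicommutant_inv_mxpoch; apply: bicommutantD => //; exact: bicommutant_scalar.
  by rewrite -mulmxA (inv_mxpochS _ Du).
clearbody H H'' S S'.
have -> : A *m ((n.+1)`!%:R^-1 *: (L *m H)) = (n.+1)`!%:R^-1 *: (L *m (A *m H)).
  by apply: mulmx_pull; apply: inK => //; exact: bicommutantM.
have -> : G *m (A *m ((A + 1%:M) *m a)) *m (D *m c) *m Z *m H'' = L *m (A *m H'').
  by apply: mulmx_pull2; apply: inK => //; exact: bicommutantM.
have -> : z *: (n`!%:R^-1 *: (G *m a *m c *m (z *: Z) *m S)) =
    (z ^+ 2 * n`!%:R^-1) *: (L *m S').
  rewrite -scalemxAr -scalemxAl !scalerA expr2 [z * _ * z]mulrAC; congr (_ *: _).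
  rewrite /L mulmx_pull2; try by apply: inK => //; exact: bicommutantM.
  by rewrite mulmx_pull3 ?SS'; try exact: inK.
by rewrite scalerA in core; exact: (scale_mulmxl _ core).
Qed.

End Assembly.

Theorem theorem4p10 (R : realType) (N : nat) (A B : 'M[R[i]]_N) (n : nat)
    (z : R[i]) (comm_AB : A *m B = B *m A) (n_gt0 : (1 <= n)%N)
    (z_slit : ~ (complex.Im z = 0 /\ complex.Re z <= 0)) :
  [/\ bateman_defined A B -> bateman_defined A (B - 1%:M) ->
      bateman n A B z = bateman n.-1 A B z + bateman n A (B - 1%:M) z,
      bateman_defined A (B - (2^-1)%:M) -> bateman_defined (A - 1%:M) B ->
      bateman_defined (A + 1%:M) B ->
      A *m bateman n A (B - (2^-1)%:M) z =
      z *: bateman n (A - 1%:M) B z + z *: bateman n.-1 (A + 1%:M) B z &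
      bateman_defined A B -> bateman_defined (A - 1%:M) (B + (2^-1)%:M) ->
      (A + n%:R%:M) *m bateman n A B z =
      (n%:R%:M + B + 2^-1 *: A) *m bateman n.-1 A B z +
      z *: bateman n (A - 1%:M) (B + (2^-1)%:M) z].
Proof.
have z0 : z != 0 by apply/eqP => z0; apply: z_slit; rewrite z0.
(* The slit excludes z = 0, and z <> 0 is what cexp (clog z) = z needs. *)
case: n n_gt0 => // n _; split.
- exact: bateman_lower_snd.
- by move=> dA dAm _; exact: bateman_neighbours_fst.
- exact: bateman_lower_fst.
Qed.
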